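(* Let $d\ge2$. For every $d$-dimensional simplex $S$ in $\mathbb{H}^d$, $\tanh\mathrm{cirr}(S)\ge d\tanh\mathrm{ir}(S)$, with equality if and only if $S$ is regular. Furthermore, for $d\in\{2,3\}$ and every $d$-dimensional simplex $S$ in $\mathbb{S}^d$, $\tan\mathrm{cirr}(S)\ge d\tan\mathrm{ir}(S)$, with equality if and only if $S$ is regular.
   Context: $\mathrm{ir}(S)$ (inradius) is the radius of a largest ball contained in $S$ and $\mathrm{cirr}(S)$ (circumradius) is the radius of a smallest ball containing $S$. A spherical simplex is the spherical convex hull of $d+1$ points in an open hemisphere of $\mathbb{S}^d$ not on a common great subsphere. A regular simplex has all edges of equal length. *)

(* Defs.v *)
From HB Require Import structures.
From mathcomp Require Import all_boot all_order all_algebra.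
From mathcomp Require Import all_classical all_reals all_analysis.
Set Implicit Arguments. Unset Strict Implicit. Unset Printing Implicit Defensive.
Import Order.TTheory GRing.Theory Num.Theory.
Local Open Scope classical_set_scope.
Local Open Scope ring_scope.

Section Geometry.
Variables (R : realType) (d : nat).
Notation pt := 'rV[R]_d.+1.

Definition coshR (x : R) : R := (expR x + expR (- x)) / 2.
Definition sinhR (x : R) : R := (expR x - expR (- x)) / 2.
Definition tanhR (x : R) : R := sinhR x / coshR x.
Definition acoshR (t : R) : R := ln (t + Num.sqrt (t ^+ 2 - 1)).

Definition edot (x y : pt) : R := \sum_(i < d.+1) x ord0 i * y ord0 i.
Definition ldot (x y : pt) : R :=
  - (x ord0 ord0 * y ord0 ord0) + \sum_(i < d.+1 | i != ord0) x ord0 i * y ord0 i.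

Definition Hd : set pt := [set x | ldot x x = -1 /\ 0 < x ord0 ord0].
Definition Sd : set pt := [set x | edot x x = 1].

Definition hdist (x y : pt) : R := acoshR (- ldot x y).
Definition sdist (x y : pt) : R := acos (edot x y).

Definition hball (c : pt) (r : R) : set pt := [set x | Hd x /\ hdist c x <= r].
Definition sball (c : pt) (r : R) : set pt := [set x | Sd x /\ sdist c x <= r].

(* Vertices of a d-simplex: d+1 linearly independent vectors of R^(d+1)
   (i.e. not on a common hyperplane / great subsphere). *)
Definition vmx (v : 'I_d.+1 -> pt) : 'M[R]_d.+1 := \matrix_(i, j) v i ord0 j.
Definition lin_indep (v : 'I_d.+1 -> pt) := \det (vmx v) != 0.

(* The (hyperbolic / spherical) convex hull of the vertices: the points of the
   space lying in the cone spanned by the vertices. *)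
Definition cone (v : 'I_d.+1 -> pt) : set pt :=
  [set x | exists l : 'I_d.+1 -> R, (forall i, 0 <= l i) /\ x = \sum_i l i *: v i].
Definition hsimplex (v : 'I_d.+1 -> pt) : set pt := Hd `&` cone v.
Definition ssimplex (v : 'I_d.+1 -> pt) : set pt := Sd `&` cone v.

Definition is_hyp_simplex (v : 'I_d.+1 -> pt) :=
  (forall i, Hd (v i)) /\ lin_indep v.
Definition open_hemisphere (v : 'I_d.+1 -> pt) :=
  exists u : pt, forall i, 0 < edot u (v i).
Definition is_sph_simplex (v : 'I_d.+1 -> pt) :=
  (forall i, Sd (v i)) /\ open_hemisphere v /\ lin_indep v.

Definition h_ir (S : set pt) : R :=
  sup [set r | 0 <= r /\ exists c, Hd c /\ hball c r `<=` S].
Definition h_cirr (S : set pt) : R :=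
  inf [set r | exists c, Hd c /\ S `<=` hball c r].
Definition s_ir (S : set pt) : R :=
  sup [set r | 0 <= r /\ exists c, Sd c /\ sball c r `<=` S].
Definition s_cirr (S : set pt) : R :=
  inf [set r | exists c, Sd c /\ S `<=` sball c r].

Definition h_regular (v : 'I_d.+1 -> pt) :=
  forall i j k l, i != j -> k != l -> hdist (v i) (v j) = hdist (v k) (v l).
Definition s_regular (v : 'I_d.+1 -> pt) :=
  forall i j k l, i != j -> k != l -> sdist (v i) (v j) = sdist (v k) (v l).

End Geometry.

(* Main.v *)
Require Import Defs.
From HB Require Import structures.
From mathcomp Require Import all_boot all_order all_algebra.
From mathcomp Require Import all_classical all_reals all_analysis.
From mathcomp Require Import ring lra.
Import Order.TTheory GRing.Theory Num.Theory.
Import numFieldNormedType.Exports.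
Local Open Scope ring_scope.
Set Implicit Arguments.
Unset Strict Implicit.

(* Let [n_i] be the inward unit normal of the facet opposite to the vertex
   [v_i], so that [<n_i, v_j> = 0] for [j <> i], and put [h_i = <n_i, v_i> > 0].
   Then [<x, y> = sum_i <n_i, x> <v_i, y> / h_i].  A ball of centre [p] and
   radius [r] lies in the simplex iff [<n_i, p> >= sin r] for all [i], and one of
   centre [q] and radius [rho] contains it iff [<v_i, q> >= cos rho] (resp. with
   [sinh r], and [- <v_i, q> <= cosh rho]).

   On the sphere put [y_i = n_i / <n_i, p> - p], of norm at most [cot r], and
   [w_i = v_i / <v_i, q> - q], of norm at most [tan rho].  With the weights
   [om_i = <n_i, p> <v_i, q> / h_i], of sum [c = <p, q>], the expansion gives
   [sum_i om_i <y_i, w_i> = d - 1 + c^2], so Cauchy-Schwarz yields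
   [tan rho / tan r >= (d - 1) / c + c >= d]; this works in every dimension.
   In hyperbolic space one projects radially from the incentre [p] instead: the
   containing ball becomes an ellipsoid with half-axes at most [tanh rho], and
   [w_i] is the vector from its Euclidean centre to the projected vertex; the
   corresponding sum is exactly [d].  Equality forces [p = q] and [n_i] to be a
   fixed affine function of [v_i], whence all [<v_i, v_j>] agree.

   The largest ball inside a spherical simplex need not touch every facet, so
   its existence, like that of the smallest containing ball, is obtained by
   compactness. *)

(** * Euclidean and Lorentzian forms *)

Section Form.
Variables (R : realType) (d : nat).
Implicit Types (s t : R) (x y z w p q : 'rV[R]_d.+1).

(* The two geometries are treated together: [form 1] is the Euclidean product
   and [form (-1)] the Lorentzian one. *)
Definition form s x y : R :=
  s * (x ord0 ord0 * y ord0 ord0) + \sum_(i < d.+1 | i != ord0) x ord0 i * y ord0 i.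

Lemma edotE x y : edot x y = form 1 x y.
Proof. by rewrite /edot /form (bigD1 ord0) //= mul1r. Qed.

Lemma ldotE x y : ldot x y = form (-1) x y.
Proof. by rewrite /ldot /form mulN1r. Qed.

Lemma formC s x y : form s x y = form s y x.
Proof.
rewrite /form [x _ _ * _]mulrC; congr (_ + _).
by apply: eq_bigr => i _; rewrite mulrC.
Qed.

Lemma formDl s x y z : form s (x + y) z = form s x z + form s y z.
Proof.
rewrite /form mxE.
under eq_bigr do rewrite mxE mulrDl.
by rewrite big_split /=; ring.
Qed.

Lemma formZl s t x y : form s (t *: x) y = t * form s x y.
Proof.
rewrite /form mxE mulrDr mulr_sumr; congr (_ + _); first by ring.
by apply: eq_bigr => i _; rewrite mxE mulrA.
Qed.

Lemma formNl s x y : form s (- x) y = - form s x y.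
Proof. by rewrite -scaleN1r formZl mulN1r. Qed.

Lemma formDr s x y z : form s z (x + y) = form s z x + form s z y.
Proof. by rewrite formC formDl !(formC s z). Qed.

Lemma formZr s t x y : form s y (t *: x) = t * form s y x.
Proof. by rewrite formC formZl (formC s y). Qed.

Lemma formNr s x y : form s y (- x) = - form s y x.
Proof. by rewrite formC formNl (formC s y). Qed.

Definition form_lin := (formDl, formDr, formZl, formZr, formNl, formNr).

Lemma form0l s x : form s 0 x = 0.
Proof. by rewrite -(scale0r 0) formZl mul0r. Qed.

Lemma form0r s x : form s x 0 = 0.
Proof. by rewrite formC form0l. Qed.

Lemma form_suml s (I : Type) (r : seq I) (P : pred I) (f : I -> 'rV[R]_d.+1) x :
  form s (\sum_(i <- r | P i) f i) x = \sum_(i <- r | P i) form s (f i) x.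
Proof.
elim/big_rec2: _ => [|i a b _ <-]; last by rewrite formDl.
by rewrite form0l.
Qed.

Lemma form_sumr s (I : Type) (r : seq I) (P : pred I) (f : I -> 'rV[R]_d.+1) x :
  form s x (\sum_(i <- r | P i) f i) = \sum_(i <- r | P i) form s x (f i).
Proof. by rewrite formC form_suml; under eq_bigr do rewrite formC. Qed.

Lemma form0_ge0 x : 0 <= form 0 x x.
Proof. by rewrite /form mul0r add0r sumr_ge0 // => i _; rewrite -expr2 sqr_ge0. Qed.

(** [form 0] is the Euclidean product of the spatial coordinates; splitting it off reduces
    Lorentzian claims to its nonnegativity. *)
Lemma form_form0 s x y :
  form s x y = s * (x ord0 ord0 * y ord0 ord0) + form 0 x y.
Proof. by rewrite /form mul0r add0r. Qed.

Lemma form0_eq0 x : form 0 x x = 0 -> x ord0 ord0 = 0 -> x = 0.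
Proof.
rewrite /form mul0r add0r => /eqP; rewrite psumr_eq0; last first.
  by move=> i _; rewrite -expr2 sqr_ge0.
move=> /allP h h0; apply/matrixP => i j; rewrite ord1 mxE.
have [->//|j0] := eqVneq j ord0.
have := h j (mem_index_enum _); rewrite j0 implyTb mulf_eq0 orbb.
by move/eqP.
Qed.

Lemma form1_ge0 x : 0 <= form 1 x x.
Proof. by rewrite form_form0 mul1r -expr2 addr_ge0 ?sqr_ge0 ?form0_ge0. Qed.

Lemma form1_eq0 x : form 1 x x = 0 -> x = 0.
Proof.
rewrite form_form0 mul1r -expr2 => h.
have h1 := sqr_ge0 (x ord0 ord0); have h2 := form0_ge0 x.
apply: form0_eq0; first by lra.
by apply/eqP; rewrite -sqrf_eq0; apply/eqP; lra.
Qed.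

(** Positive definiteness on the orthogonal complement of [p]: the property on which Cauchy-Schwarz
    rests in both geometries. *)
Definition posdef_orth s p := forall w, form s w p = 0 ->
  0 <= form s w w /\ (form s w w = 0 -> w = 0).

Lemma posdef_orth_sph p : posdef_orth 1 p.
Proof. by move=> w _; split; [exact: form1_ge0 | exact: form1_eq0]. Qed.

Lemma Hd_form p : Hd p <-> form (-1) p p = -1 /\ 0 < p ord0 ord0.
Proof. by rewrite /Hd /mkset ldotE. Qed.

Lemma posdef_orth_hyp p : Hd p -> posdef_orth (-1) p.
Proof.
move=> /Hd_form[pp p0] w wp.
move: pp wp; rewrite form_form0 (form_form0 _ w p) => pp wp.
set P := p ord0 ord0 in pp p0 wp *; set W := w ord0 ord0 in wp *.
(* The vector [P *: w - W *: p] has vanishing first coordinate, and the scaled Lorentzian square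
   becomes a sum of two nonnegative terms. *)
have e : P ^+ 2 * form (-1) w w = form 0 (P *: w - W *: p) (P *: w - W *: p) + W ^+ 2.
  rewrite !form_lin (formC 0 p w) (form_form0 (-1)) -/W.
  have -> : form 0 w p = W * P by lra.
  have -> : form 0 p p = P ^+ 2 - 1 by rewrite -expr2 in pp; lra.
  by ring.
have P2 : 0 < P ^+ 2 by rewrite exprn_gt0.
have h1 := form0_ge0 (P *: w - W *: p); have h2 := sqr_ge0 W.
split; first by rewrite -(pmulr_rge0 _ P2) e; lra.
move=> ww; rewrite ww mulr0 in e.
have W0 : W = 0 by apply/eqP; rewrite -sqrf_eq0; apply/eqP; lra.
have : form 0 (P *: w) (P *: w) = 0.
  by move: e; rewrite W0 scale0r subr0 expr0n /= addr0.
rewrite !form_lin => /eqP; rewrite !mulf_eq0 (gt_eqF p0) /= => /eqP ww0.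
exact: form0_eq0.
Qed.

(** Expand the square of [W *: y - Y *: w]. Bounds [Y] and [W] replace the norms, so that one pair
    serves all facets and vertices at once. *)
Lemma cauchy_schwarz s p y w (Y W : R) : posdef_orth s p ->
  form s y p = 0 -> form s w p = 0 -> 0 <= Y -> 0 <= W ->
  form s y y <= Y ^+ 2 -> form s w w <= W ^+ 2 ->
  form s y w <= Y * W /\ (form s y w = Y * W -> W *: y = Y *: w).
Proof.
move=> pd yp wp Y0 W0 yY wW.
have [yy0 yy] := pd _ yp; have [ww0 ww] := pd _ wp.
have [Wz|Wn] := eqVneq W 0.
  have -> : w = 0 by apply: ww; move: wW; rewrite Wz expr0n /=; lra.
  by rewrite Wz formC form0l mulr0 scale0r scaler0; split.
have [Yz|Yn] := eqVneq Y 0.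
  have -> : y = 0 by apply: yy; move: yY; rewrite Yz expr0n /=; lra.
  by rewrite Yz form0l mul0r scale0r scaler0; split.
have Yp : 0 < Y by rewrite lt_neqAle eq_sym Yn.
have Wp : 0 < W by rewrite lt_neqAle eq_sym Wn.
have YW : 0 < Y * W by exact: mulr_gt0.
have op : form s (W *: y - Y *: w) p = 0 by rewrite !form_lin yp wp; ring.
have [d0 dd] := pd _ op.
have e : form s (W *: y - Y *: w) (W *: y - Y *: w) =
    W ^+ 2 * form s y y - 2 * (Y * W) * form s y w + Y ^+ 2 * form s w w.
  by rewrite !form_lin (formC s w y); ring.
have le1 : W ^+ 2 * form s y y <= (Y * W) ^+ 2.
  by rewrite exprMn mulrC ler_wpM2r // sqr_ge0.
have le2 : Y ^+ 2 * form s w w <= (Y * W) ^+ 2.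
  by rewrite exprMn ler_wpM2l // sqr_ge0.
split.
  by rewrite -(ler_pM2l YW); move: d0; rewrite e expr2 in le1 le2 *; lra.
move=> yw; apply/eqP; rewrite -subr_eq0; apply/eqP/dd.
by apply/eqP; rewrite eq_le d0 andbT e yw; rewrite expr2 in le1 le2; lra.
Qed.

End Form.

(** * Facet normals and the main inequalities *)

Section Simplex.
Variables (R : realType) (d : nat).
Implicit Types (s : R) (x y z w p q c : 'rV[R]_d.+1).
Implicit Types (v n : 'I_d.+1 -> 'rV[R]_d.+1) (h : 'I_d.+1 -> R).

(** The reversed Cauchy-Schwarz inequality. With [s] the spatial product, nonnegativity of the
    spatial square of [Y *: x - X *: y] reads [2 X Y (X Y - s) >= X^2 + Y^2], and the right side is
    at least [2 X Y]. *)
Lemma Hd_form_le x y : Hd x -> Hd y -> form (-1) x y <= -1.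
Proof.
move=> /Hd_form[xx x0] /Hd_form[yy y0].
move: xx yy; rewrite !(form_form0 (-1)).
set X := x ord0 ord0 in x0 *; set Y := y ord0 ord0 in y0 * => xx yy.
have := form0_ge0 (Y *: x - X *: y).
rewrite !form_lin (formC 0 y x).
have -> : form 0 x x = X ^+ 2 - 1 by rewrite expr2; lra.
have -> : form 0 y y = Y ^+ 2 - 1 by rewrite expr2; lra.
set s := form 0 x y => h.
have XY : 0 < X * Y by exact: mulr_gt0.
have h2 : 0 <= (X - Y) ^+ 2 by exact: sqr_ge0.
have : 0 <= (X * Y) * (X * Y - s - 1) by nra.
by rewrite pmulr_rge0 //; lra.
Qed.

(** The sign of the product with a point of the upper sheet tells the two sheets apart: on the lower
    one, [- x] would lie in [Hd] and the product would be positive. *)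
Lemma Hd_of_form_lt0 c x :
  Hd c -> form (-1) x x = -1 -> form (-1) x c < 0 -> Hd x.
Proof.
move=> Hc xx xc; apply/Hd_form; split=> //.
have [//|x0|x0] := ltgtP 0 (x ord0 ord0).
  have : Hd (- x) by apply/Hd_form; rewrite !form_lin opprK xx mxE oppr_gt0.
  by move=> /Hd_form_le/(_ Hc); rewrite formNl; lra.
move: xx; rewrite form_form0 -x0; have := form0_ge0 x; lra.
Qed.

(** The vectors [n i / h i] form the dual basis of [v]. Keeping the expansion in the vertices as a
    clause confines matrices to the existence proof. *)
Definition facet_normals s v n h :=
  [/\ forall i, form s (n i) (n i) = 1, forall i, 0 < h i,
      forall i j, form s (n i) (v j) = if i == j then h i else 0 &
      forall x, x = \sum_i (form s (n i) x / h i) *: v i].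

(** The inverse of the vertex matrix yields the dual basis. Normalising it requires dual vectors of
    positive square, which is a genuine condition for the Lorentzian form. *)
Lemma facet_normals_exist s v : s * s = 1 -> lin_indep v ->
  (forall i x, x != 0 -> (forall j, j != i -> form s x (v j) = 0) ->
     0 < form s x x) ->
  exists n h, facet_normals s v n h.
Proof.
move=> ss; rewrite /lin_indep -unitfE -unitmxE => Vu pos.
pose U := invmx (vmx v).
have VU : vmx v *m U = 1%:M by rewrite mulmxV.
(* The factor on the first entry cancels the [s] inside [form s], because [s * s = 1]. *)
pose u i : 'rV[R]_d.+1 := \row_j ((if j == ord0 then s else 1) * U j i).
have uE i x : form s (u i) x = (x *m U) ord0 i.
  rewrite /form [RHS]mxE [RHS](bigD1 ord0) //= /u !mxE eqxx.
  congr (_ + _); first by rewrite !mulrA ss mul1r mulrC.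
  by apply: eq_bigr => j /negbTE j0; rewrite !mxE j0 mul1r mulrC.
have uv i j : form s (u i) (v j) = (i == j)%:R.
  rewrite uE; have := congr1 (fun M : 'M[R]_d.+1 => M j i) VU.
  rewrite !mxE eq_sym => <-.
  by apply: eq_bigr => l _; rewrite !mxE.
have u0 i : u i != 0.
  apply/eqP => ui; have := uv i i; rewrite ui eqxx form0l.
  by move/eqP; rewrite eq_sym oner_eq0.
have upos i : 0 < form s (u i) (u i).
  by apply: (pos i) => // j ji; rewrite uv eq_sym (negbTE ji).
pose N i := Num.sqrt (form s (u i) (u i)).
have N0 i : 0 < N i by rewrite sqrtr_gt0.
exists (fun i => (N i)^-1 *: u i), (fun i => (N i)^-1); split.
- move=> i; rewrite !form_lin -[X in _ * (_ * X)]sqr_sqrtr ?ltW //.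
  by rewrite -/(N i); field; rewrite gt_eqF.
- by move=> i; rewrite invr_gt0.
- by move=> i j; rewrite formZl uv; case: eqP => _; rewrite ?mulr1 ?mulr0.
- move=> x.
  have -> : \sum_i (form s ((N i)^-1 *: u i) x / (N i)^-1) *: v i =
            (x *m U) *m vmx v.
    apply/rowP => j; rewrite summxE mxE; apply: eq_bigr => i _.
    rewrite !mxE formZl uE mxE; congr (_ * _).
    by field; rewrite gt_eqF.
  by rewrite -mulmxA mulVmx // mulmx1.
Qed.

Lemma other_index (i : 'I_d.+1) : (2 <= d)%N -> exists j : 'I_d.+1, j != i.
Proof.
move=> d2; have [->|i0] := eqVneq i ord0; last by exists ord0; rewrite eq_sym.
by exists ord_max; rewrite -val_eqE /= -lt0n (ltn_trans _ d2).
Qed.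

Section Dual.
Variables (s : R) (v n : 'I_d.+1 -> 'rV[R]_d.+1) (h : 'I_d.+1 -> R).
Hypothesis fn : facet_normals s v n h.

Lemma facet_normals_form x y :
  form s x y = \sum_i form s (n i) x * form s (v i) y / h i.
Proof.
have [_ _ _ e] := fn; rewrite {1}(e x) form_suml.
by apply: eq_bigr => i _; rewrite formZl mulrAC.
Qed.

(** Pairing [n i = a v_i + b p] with [v j] for [j != i] gives [0 = a <v_i, v_j> + b e], which
    determines the product. *)
Lemma equal_products_of_affine (a b e : R) p : a != 0 ->
  (forall i, n i = a *: v i + b *: p) -> (forall i, form s (v i) p = e) ->
  forall i j k l, i != j -> k != l ->
    form s (v i) (v j) = form s (v k) (v l).
Proof.
have [_ _ nv _] := fn => a0 ne ve.
suff H i j : i != j -> form s (v i) (v j) = - (b * e) / a.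
  by move=> i j k l ij kl; rewrite !H.
move=> /negbTE ij; have := nv i j; rewrite ij ne !form_lin (formC _ p) ve => e0.
apply: (mulfI a0); rewrite mulrCA mulfV // mulr1; lra.
Qed.

End Dual.

(** * Weighted sums and the two core inequalities *)

Lemma weighted_sum_le (I : finType) (om th : I -> R) (Th : R) :
  (forall i, 0 <= om i) -> (forall i, th i <= Th) ->
  \sum_i om i * th i <= (\sum_i om i) * Th.
Proof.
by move=> om0 thT; rewrite mulr_suml; apply: ler_sum => i _; rewrite ler_wpM2l.
Qed.

Lemma weighted_sum_eq (I : finType) (om th : I -> R) (Th : R) :
  (forall i, 0 < om i) -> (forall i, th i <= Th) ->
  \sum_i om i * th i = (\sum_i om i) * Th -> forall i, th i = Th.
Proof.
move=> om0 thT /eqP; rewrite eq_sym -subr_eq0 mulr_suml -sumrB psumr_eq0.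
  move=> /allP H i; have := H i (mem_index_enum i).
  by rewrite -mulrBr mulf_eq0 gt_eqF //= subr_eq0 => /eqP.
by move=> i _; rewrite subr_ge0 ler_wpM2l // ltW.
Qed.

Lemma sph_le1 p q : form 1 p p = 1 -> form 1 q q = 1 ->
  form 1 p q <= 1 /\ (form 1 p q = 1 -> p = q).
Proof.
move=> pp qq.
have e : form 1 (p - q) (p - q) = 2 - 2 * form 1 p q.
  by rewrite !form_lin (formC _ q p); lra.
split; first by have := form1_ge0 (p - q); lra.
by move=> pq; apply/subr0_eq/form1_eq0; rewrite e; lra.
Qed.

(** Here [m], [k], [Y], [W] stand for [sin r], [cos rho], [cot r], [tan rho], tied by polynomial
    identities so that no trigonometry enters. *)
Lemma sph_core v n h p q (m k Y W : R) : (2 <= d)%N ->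
  facet_normals 1 v n h -> (forall i, form 1 (v i) (v i) = 1) ->
  form 1 p p = 1 -> form 1 q q = 1 -> 0 < m -> 0 < k -> 0 <= Y -> 0 <= W ->
  m ^+ 2 * Y ^+ 2 = 1 - m ^+ 2 -> k ^+ 2 * W ^+ 2 = 1 - k ^+ 2 ->
  (forall i, m <= form 1 (n i) p) -> (forall i, k <= form 1 (v i) q) ->
  d%:R <= Y * W /\
  (Y * W = d%:R -> forall i j k l, i != j -> k != l ->
     form 1 (v i) (v j) = form 1 (v k) (v l)).
Proof.
move=> d2 fn vv pp qq m0 k0 Y0 W0 eY eW mn kv.
have [nn h0 nv _] := fn.
pose nu i := form 1 (n i) p; pose ka i := form 1 (v i) q.
have nu0 i : 0 < nu i by exact: lt_le_trans (mn i).
have ka0 i : 0 < ka i by exact: lt_le_trans (kv i).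
pose y i := (nu i)^-1 *: n i - p; pose w i := (ka i)^-1 *: v i - q.
pose om i := nu i * ka i / h i; pose c := form 1 p q.
have om0 i : 0 < om i by rewrite divr_gt0 // mulr_gt0.
have somE : \sum_i om i = c by rewrite /c (facet_normals_form fn).
have c0 : 0 < c.
  rewrite -somE (bigD1 ord0) //=; apply: ltr_wpDr => //.
  by apply: sumr_ge0 => i _; exact: ltW.
have [c1 pqE] := sph_le1 pp qq; rewrite -/c in c1 pqE.
have yyE i : form 1 (y i) (y i) = (nu i)^-2 - 1.
  rewrite !form_lin nn pp (formC _ p) -/(nu i); field; exact: lt0r_neq0.
have wwE i : form 1 (w i) (w i) = (ka i)^-2 - 1.
  rewrite !form_lin vv qq (formC _ q) -/(ka i); field; exact: lt0r_neq0.
have Y2 : Y ^+ 2 = m^-2 - 1.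
  by apply: (mulfI (lt0r_neq0 (exprn_gt0 2 m0))); rewrite eY; field; rewrite gt_eqF.
have W2 : W ^+ 2 = k^-2 - 1.
  by apply: (mulfI (lt0r_neq0 (exprn_gt0 2 k0))); rewrite eW; field; rewrite gt_eqF.
have yY i : form 1 (y i) (y i) <= Y ^+ 2.
  rewrite yyE Y2 lerB // lef_pV2 ?posrE ?exprn_gt0 //.
  by rewrite ler_pXn2r ?nnegrE ?(ltW m0) ?(ltW (nu0 i)) //; exact: mn.
have wW i : form 1 (w i) (w i) <= W ^+ 2.
  rewrite wwE W2 lerB // lef_pV2 ?posrE ?exprn_gt0 //.
  by rewrite ler_pXn2r ?nnegrE ?(ltW k0) ?(ltW (ka0 i)) //; exact: kv.
have cs i : form 1 (y i) (w i) <= Y * W /\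
    (form 1 (y i) (w i) = Y * W -> W *: y i = Y *: w i).
  apply: (@cauchy_schwarz _ _ 1 0) => //; first exact: posdef_orth_sph.
    by rewrite form0r.
  by rewrite form0r.
(* The four terms sum to [d + 1], [- <p, p>], [- <q, q>] and [c^2]. *)
have sumE : \sum_i om i * form 1 (y i) (w i) = d%:R - 1 + c ^+ 2.
  transitivity (\sum_i (1 - form 1 (n i) p * form 1 (v i) p / h i
      - form 1 (n i) q * form 1 (v i) q / h i + om i * c)).
    apply: eq_bigr => i _; rewrite /y /w !form_lin nv eqxx (formC _ p (v i)) -/c.
    rewrite -/(nu i) -/(ka i) /om; field.
    by rewrite !lt0r_neq0.
  rewrite big_split /= !sumrB -!(facet_normals_form fn) -mulr_suml somE pp qq.
  by rewrite big_const_ord iter_addr_0 -natr1; ring.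
have d2R : 2 <= d%:R :> R by rewrite (ler_nat R 2 d).
have cle : d%:R - 1 + c ^+ 2 <= c * (Y * W).
  rewrite -sumE -somE; apply: weighted_sum_le => i; first exact: ltW.
  by have [] := cs i.
(* The difference of the two sides is [(1 - c) (d - 1 - c)], nonnegative for [c <= 1] and [d >= 2],
   and positive for [c < 1]. *)
have cd : c * d%:R <= d%:R - 1 + c ^+ 2 by nra.
split; first by rewrite -(ler_pM2l c0); exact: le_trans cle.
move=> YW; rewrite YW in cle.
have cE : c = 1.
  apply/eqP; rewrite eq_le c1 /= leNgt; apply/negP => clt.
  have : 0 < (1 - c) * (d%:R - 1 - c) by apply: mulr_gt0; lra.
  by rewrite expr2 in cle; lra.
have pq := pqE cE.
have YW0 : 0 < Y * W by rewrite YW; lra.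
have Yn : Y != 0 by apply: contraTneq YW0 => ->; rewrite mul0r ltxx.
have Wn : W != 0 by apply: contraTneq YW0 => ->; rewrite mulr0 ltxx.
(* Since the weights are positive, equality of the sums makes every single Cauchy-Schwarz bound
   tight; then all [nu i] equal [m] and all [ka i] equal [k]. *)
have csE i : form 1 (y i) (w i) = Y * W.
  apply: (weighted_sum_eq (th := fun i => form 1 (y i) (w i)) om0) => [j|].
    by have [] := cs j.
  by rewrite sumE somE cE YW; ring.
have yw i : W *: y i = Y *: w i by have [_] := cs i; exact.
have nuE i : nu i = m.
  have e : form 1 (y i) (y i) = Y ^+ 2.
    apply: (mulfI Wn); rewrite -formZr yw formZr csE; ring.
  have : (nu i)^-2 = m^-2 by move: e; rewrite yyE Y2; lra.
  by move/invr_inj/eqP; rewrite eqrXn2 ?ltW // => /eqP.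
have kaE i : ka i = k.
  have e : form 1 (w i) (w i) = W ^+ 2.
    by apply: (mulfI Yn); rewrite -formZl -yw formZl csE; ring.
  have : (ka i)^-2 = k^-2 by move: e; rewrite wwE W2; lra.
  by move/invr_inj/eqP; rewrite eqrXn2 ?ltW // => /eqP.
(* The coefficients come from [n_i = m (y_i + p)], [y_i = (Y / W) w_i] and [w_i = v_i / k - p]. *)
apply: (equal_products_of_affine fn (a := m * (Y / W / k)) (b := m * (1 - Y / W))
          (e := k) (p := p)).
- by rewrite !mulf_neq0 ?invr_eq0 ?(lt0r_neq0 m0) ?(lt0r_neq0 k0).
- move=> i; have e : y i = (Y / W) *: w i.
    by apply: (scalerI Wn); rewrite yw scalerA; congr (_ *: _); field.
  have -> : n i = m *: (y i + p).
    by rewrite /y subrK nuE scalerA mulfV ?scale1r ?lt0r_neq0.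
  rewrite e /w kaE -pq scalerBr scalerA scalerDr scalerBr !scalerA.
  by rewrite mulrBr mulr1 scalerBl -addrA; congr (_ + _); rewrite addrC.
- by move=> i; rewrite pq -/(ka i).
Qed.

(** Here [m], [k], [Y], [W] stand for [sinh r], [cosh rho], [coth r], [tanh rho]. *)
Lemma hyp_core v n h p q (m k Y W : R) : (2 <= d)%N ->
  facet_normals (-1) v n h -> (forall i, Hd (v i)) ->
  Hd p -> Hd q -> 0 < m -> 0 < k -> 0 <= Y -> 0 <= W ->
  m ^+ 2 * Y ^+ 2 = 1 + m ^+ 2 -> k ^+ 2 * W ^+ 2 = k ^+ 2 - 1 ->
  (forall i, m <= form (-1) (n i) p) -> (forall i, - form (-1) (v i) q <= k) ->
  d%:R <= Y * W /\
  (Y * W = d%:R -> forall i j k l, i != j -> k != l ->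
     form (-1) (v i) (v j) = form (-1) (v k) (v l)).
Proof.
move=> d2 fn Hv Hp Hq m0 k0 Y0 W0 eY eW mn kv.
have [nn h0 nv _] := fn.
have [pp _] := (Hd_form p).1 Hp; have [qq _] := (Hd_form q).1 Hq.
have vv i : form (-1) (v i) (v i) = -1 by have [] := (Hd_form (v i)).1 (Hv i).
pose nu i := form (-1) (n i) p.
have [ka vp] : exists ka, forall i, form (-1) (v i) p = - ka i.
  by exists (fun i => - form (-1) (v i) p) => i; rewrite opprK.
have nu0 i : 0 < nu i by exact: lt_le_trans (mn i).
have ka0 i : 0 < ka i by have := Hd_form_le (Hv i) Hp; rewrite vp; lra.
pose a := - form (-1) p q.
have pq : form (-1) p q = - a by rewrite opprK.
have a1 : 1 <= a by have := Hd_form_le Hp Hq; rewrite pq; lra.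
have k1 : 1 <= k ^+ 2.
  have : 0 <= k ^+ 2 * W ^+ 2 by rewrite mulr_ge0 ?sqr_ge0.
  by rewrite eW subr_ge0.
have kab : 0 < k ^+ 2 + a ^+ 2 - 1 by nra.
(* This value minimises [1 - 2 g a + g^2 (k^2 + a^2 - 1)], the bound on [<w_i, w_i>] found below;
   the minimum is [1 - g a]. The vector [q - a p] is the component of [q] orthogonal to [p]. *)
pose g := a / (k ^+ 2 + a ^+ 2 - 1).
have gE : g * (k ^+ 2 + a ^+ 2 - 1) = a by rewrite /g divfK // gt_eqF.
have [C CE] : exists C, C = p + g *: (q - a *: p) by eexists.
have Cp : form (-1) C p = -1.
  by rewrite CE !form_lin (formC _ q p) pp pq; ring.
have CC : form (-1) C C = -1 + g ^+ 2 * (a ^+ 2 - 1).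
  by rewrite CE !form_lin (formC _ q p) pp pq qq; ring.
pose y i := (nu i)^-1 *: n i + p; pose w i := (ka i)^-1 *: v i - C.
(* Unlike on the sphere, both factors are taken at [p], so the weights sum to [- <p, p> = 1]. *)
pose om i := nu i * ka i / h i.
have om0 i : 0 < om i by rewrite divr_gt0 // mulr_gt0.
have somE : \sum_i om i = 1.
  apply: oppr_inj; rewrite -pp (facet_normals_form fn) -sumrN.
  by apply: eq_bigr => i _; rewrite vp /om -/(nu i); ring.
have yp i : form (-1) (y i) p = 0.
  by rewrite /y !form_lin pp -/(nu i) mulVf ?lt0r_neq0 // subrr.
have wp i : form (-1) (w i) p = 0.
  by rewrite /w !form_lin Cp vp mulrN mulVf ?lt0r_neq0 //; ring.
have yyE i : form (-1) (y i) (y i) = (nu i)^-2 + 1.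
  rewrite !form_lin nn pp (formC _ p) -/(nu i); field; exact: lt0r_neq0.
have Y2 : Y ^+ 2 = m^-2 + 1.
  by apply: (mulfI (lt0r_neq0 (exprn_gt0 2 m0))); rewrite eY; field; rewrite gt_eqF.
have W2 : W ^+ 2 = 1 - k^-2.
  by apply: (mulfI (lt0r_neq0 (exprn_gt0 2 k0))); rewrite eW; field; rewrite gt_eqF.
have yY i : form (-1) (y i) (y i) <= Y ^+ 2.
  rewrite yyE Y2 lerD // lef_pV2 ?posrE ?exprn_gt0 //.
  by rewrite ler_pXn2r ?nnegrE ?(ltW m0) ?(ltW (nu0 i)) //; exact: mn.
(* After clearing denominators this is [(k^2 - 1) (a^2 - 1) >= 0]. *)
have ga : k^-2 <= g * a.
  rewrite -(ler_pM2r kab) mulrAC gE -(ler_pM2l (exprn_gt0 2 k0)) mulrA mulfV.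
    have : 0 <= (k ^+ 2 - 1) * (a ^+ 2 - 1) by apply: mulr_ge0; nra.
    by rewrite mul1r; lra.
  by rewrite lt0r_neq0 // exprn_gt0.
(* Radially projected to the hyperplane [form (-1) _ p = -1], the ball with
   centre [q] is an ellipsoid centred at [C] of half-axes at most [W]. *)
have wwle i : form (-1) (w i) (w i) <= 1 - g * a.
  pose z := - form (-1) (v i) q / ka i.
  have zk : z ^+ 2 / k ^+ 2 <= (ka i)^-2.
    rewrite /z expr_div_n mulrAC ler_pdivrMr ?exprn_gt0 //.
    rewrite mulVf ?lt0r_neq0 ?exprn_gt0 // ler_pdivrMr ?exprn_gt0 // mul1r.
    rewrite ler_pXn2r ?nnegrE ?(ltW k0) //.
    by have := Hd_form_le (Hv i) Hq; lra.
  have vqz : form (-1) (v i) q = - z * ka i by rewrite mulNr divfK ?opprK ?lt0r_neq0.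
  have e : form (-1) (w i) (w i) =
      - (ka i)^-2 + 1 - 2 * g * (a - z) + g ^+ 2 * (a ^+ 2 - 1).
    rewrite /w !form_lin CC vv.
    rewrite (formC _ C (v i)) CE !form_lin vp vqz; field; exact: lt0r_neq0 (ka0 i).
  (* Completing the square bounds [2 g z - z^2 / k^2] by [g^2 k^2], whatever [z] is. *)
  have sq : 0 <= (z - g * k ^+ 2) ^+ 2 / k ^+ 2.
    by rewrite divr_ge0 ?sqr_ge0.
  have sqE : (z - g * k ^+ 2) ^+ 2 / k ^+ 2 =
      z ^+ 2 / k ^+ 2 - 2 * g * z + g ^+ 2 * k ^+ 2 by field; exact: lt0r_neq0.
  have gE2 : g ^+ 2 * k ^+ 2 + g ^+ 2 * (a ^+ 2 - 1) = g * a.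
    by rewrite -[RHS](congr1 ( *%R g) gE); ring.
  by rewrite e; lra.
have wW i : form (-1) (w i) (w i) <= W ^+ 2.
  by rewrite W2; apply: le_trans (wwle i) _; lra.
have cs i : form (-1) (y i) (w i) <= Y * W /\
    (form (-1) (y i) (w i) = Y * W -> W *: y i = Y *: w i).
  by apply: (cauchy_schwarz (posdef_orth_hyp Hp)).
(* The constant terms give [d + 1], and the others sum to [<C, p> = -1]. *)
have sumE : \sum_i om i * form (-1) (y i) (w i) = d%:R.
  transitivity (\sum_i (1 + form (-1) (n i) C * form (-1) (v i) p / h i)).
    apply: eq_bigr => i _.
    rewrite /y /w !form_lin.
    rewrite nv eqxx (formC _ p (v i)) (formC _ p C) Cp vp /om; field.
    by rewrite !lt0r_neq0.
  rewrite big_split /= -!(facet_normals_form fn) Cp.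
  by rewrite big_const_ord iter_addr_0 -natr1; ring.
have d2R : 2 <= d%:R :> R by rewrite (ler_nat R 2 d).
split.
  have -> : Y * W = (\sum_i om i) * (Y * W) by rewrite somE mul1r.
  rewrite -sumE; apply: weighted_sum_le => i; first exact: ltW.
  by have [] := cs i.
move=> YW.
have YW0 : 0 < Y * W by rewrite YW; lra.
have Yn : Y != 0 by apply: contraTneq YW0 => ->; rewrite mul0r ltxx.
have Wn : W != 0 by apply: contraTneq YW0 => ->; rewrite mulr0 ltxx.
have csE i : form (-1) (y i) (w i) = Y * W.
  apply: (weighted_sum_eq (th := fun i => form (-1) (y i) (w i)) om0) => [j|].
    by have [] := cs j.
  by rewrite sumE somE YW mul1r.
have yw i : W *: y i = Y *: w i by have [_] := cs i; exact.
have nuE i : nu i = m.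
  have e : form (-1) (y i) (y i) = Y ^+ 2.
    apply: (mulfI Wn); rewrite -formZr yw formZr csE; ring.
  have : (nu i)^-2 = m^-2 by move: e; rewrite yyE Y2; lra.
  by move/invr_inj/eqP; rewrite eqrXn2 ?ltW // => /eqP.
have wwE i : form (-1) (w i) (w i) = W ^+ 2.
  by apply: (mulfI Yn); rewrite -formZl -yw formZl csE; ring.
(* Tightness turns [g a >= k^-2] into an equality, so [(k^2 - 1) (a^2 - 1) = 0]; the first factor is
   nonzero because [W] is, and [a = 1] means that the centres coincide. *)
have aE : a = 1.
  have gaE : g * a = k^-2.
    by apply/eqP; rewrite eq_le ga andbT; have := wwle ord0; rewrite wwE W2; lra.
  have e : (k ^+ 2 - 1) * (a ^+ 2 - 1) = 0.
    have : (g * a) * (k ^+ 2 + a ^+ 2 - 1) * k ^+ 2 = (k ^+ 2 + a ^+ 2 - 1).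
      by rewrite gaE mulrAC mulVf ?mul1r // lt0r_neq0 // exprn_gt0.
    by rewrite [g * a * _]mulrAC gE; lra.
  move/eqP: e; rewrite -eW !mulf_eq0 ?expf_eq0 !(gt_eqF k0) !(negbTE Wn) /=.
  by rewrite subr_eq0 sqrf_eq1 => /orP[/eqP//|/eqP]; lra.
have qpE : q = p.
  have qpo : form (-1) (q - p) p = 0.
    by rewrite !form_lin (formC _ q p) pp pq aE; ring.
  have [_ H] := posdef_orth_hyp Hp qpo; apply/subr0_eq/H.
  by rewrite !form_lin (formC _ q p) pp qq pq aE; ring.
have Cpp : C = p by rewrite CE qpE aE scale1r subrr scaler0 addr0.
have kaE i : ka i = k.
  have e : form (-1) (w i) (w i) = 1 - (ka i)^-2.
    rewrite /w Cpp !form_lin (formC _ p (v i)) vv pp vp; field; exact: lt0r_neq0.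
  have : (ka i)^-2 = k^-2 by move: e; rewrite wwE W2; lra.
  by move/invr_inj/eqP; rewrite eqrXn2 ?ltW // => /eqP.
apply: (equal_products_of_affine fn (a := m * (Y / W / k)) (b := - m * (1 + Y / W))
          (e := - k) (p := p)).
- by rewrite !mulf_neq0 ?invr_eq0 ?(lt0r_neq0 m0) ?(lt0r_neq0 k0).
- move=> i; have e : y i = (Y / W) *: w i.
    by apply: (scalerI Wn); rewrite yw scalerA; congr (_ *: _); field.
  have -> : n i = m *: (y i - p).
    by rewrite /y addrK nuE scalerA mulfV ?scale1r ?lt0r_neq0.
  rewrite e /w kaE Cpp scalerBr scalerA scalerBr !scalerA mulrA.
  rewrite -addrA -opprD -scalerDl; congr (_ + _); rewrite -scaleNr.
  by congr (_ *: _); ring.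
- by move=> i; rewrite vp kaE.
Qed.

End Simplex.

(** * Regular simplices *)

Section Regular.
Variables (R : realType) (d : nat).
Implicit Types (v n : 'I_d.+1 -> 'rV[R]_d.+1) (h : 'I_d.+1 -> R).

(* [m] and [k] are the sine of the distance from the barycentre to the facets
   and the cosine of its distance to the vertices, in the sense of [s]. *)
Lemma regular_core (s a : R) v n h : (2 <= d)%N -> s * s = 1 ->
  facet_normals s v n h -> (forall i, form s (v i) (v i) = s) ->
  (forall i j, i != j -> form s (v i) (v j) = a) -> 0 < 1 + d%:R * (s * a) ->
  exists p (m k : R), [/\ form s p p = s, 0 < m, 0 < k,
    d%:R ^+ 2 * (m ^+ 2 * k ^+ 2) = s * (1 - k ^+ 2) * (1 - s * m ^+ 2) &
    (forall i, form s (n i) p = m) /\ (forall i, form s (v i) p = s * k)].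
Proof.
move=> d2 ss fn vv va apos; have [nn h0 nv _] := fn.
pose S := \sum_i v i; pose b := 1 + d%:R * (s * a).
have vS i : form s (v i) S = s * b.
  rewrite /S form_sumr (bigD1 i) //= vv (eq_bigr (fun=> a)); last first.
    by move=> j ji; rewrite va // eq_sym.
  rewrite sumr_const cardC1 card_ord -mulr_natl /b mulrDr mulr1 mulrCA.
  by rewrite (mulrA s) ss mul1r.
have nS i : form s (n i) S = h i.
  rewrite /S form_sumr (bigD1 i) //= nv eqxx big1 ?addr0 // => j ji.
  by rewrite nv eq_sym (negbTE ji).
pose D : R := d.+1%:R; have D0 : 0 < D by rewrite ltr0Sn.
have SS : form s S S = s * (D * b).
  rewrite {1}/S form_suml (eq_bigr (fun=> s * b)) //.
  by rewrite sumr_const card_ord -mulr_natl /D; ring.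
pose N := Num.sqrt (D * b).
have Db0 : 0 < D * b by exact: mulr_gt0.
have N0 : 0 < N by rewrite sqrtr_gt0.
have N2 : N ^+ 2 = D * b by rewrite sqr_sqrtr ?ltW.
have hE i : (1 + (d%:R - 1) * (s * a)) * h i ^+ 2 = s * (b * (1 - s * a)).
  (* This vector is orthogonal to every vertex but [v i]. Computing [<n_i, u>] directly and through
     the dual expansion yields the height. *)
  pose u := (s * b) *: v i - a *: S.
  have uv j : form s (v j) u = if i == j then b * (1 - s * a) else 0.
    rewrite /u !form_lin vS; case: eqP => [<-|/eqP ij].
      by rewrite vv mulrAC ss; ring.
    by rewrite va 1?eq_sym //; ring.
  have e : (s * b - a) * h i = b * (1 - s * a) / h i.
    have <- : form s (n i) u = (s * b - a) * h i.
      by rewrite /u !form_lin nS nv eqxx; ring.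
    rewrite (facet_normals_form fn) (bigD1 i) //= nn uv eqxx mul1r.
    rewrite big1 ?addr0 // => j ji.
    by rewrite uv eq_sym (negbTE ji) mulr0 mul0r.
  have e2 : (s * b - a) * h i ^+ 2 = b * (1 - s * a).
    by rewrite expr2 mulrA e divfK // lt0r_neq0.
  rewrite -e2 [RHS]mulrA; congr (_ * _).
  by rewrite mulrBr (mulrA s s) ss mul1r /b; ring.
have heq i : h i = h ord0.
  (* If this coefficient vanished, [hE] would force [s a = 1], and the coefficient would equal
     [d]. *)
  have c0 : 1 + (d%:R - 1) * (s * a) != 0.
    apply/eqP => e; have := hE ord0; have := hE i; rewrite e mul0r => /esym/eqP.
    rewrite !mulf_eq0 (gt_eqF apos) /=.
    have /negbTE -> : s != 0.
      by apply: contraTneq (oner_neq0 R) => s0; rewrite -ss s0 mul0r eqxx.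
    rewrite /= subr_eq0 => /eqP sa; move: e; rewrite -sa => e.
    have d2R : 2 <= d%:R :> R by rewrite (ler_nat R 2 d).
    by lra.
  have : h i ^+ 2 = h ord0 ^+ 2 by apply: (mulfI c0); rewrite !hE.
  by move/eqP; rewrite eqrXn2 ?ltW // => /eqP.
exists (N^-1 *: S), (h ord0 / N), (b / N); split.
- rewrite !form_lin SS -N2; field; exact: lt0r_neq0.
- by rewrite divr_gt0.
- by rewrite divr_gt0.
- apply: (mulIf (lt0r_neq0 (mulr_gt0 Db0 Db0))).
  rewrite !expr_div_n N2 /D /b -natr1.
  have := hE ord0; rewrite -/D.
  set H := h ord0 ^+ 2; rewrite /b => e.
  have D1 : (d%:R + 1 : R) != 0 by rewrite natr1 lt0r_neq0.
  have b1 : 1 + d%:R * (s * a) != 0 by exact: lt0r_neq0.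
  apply/eqP; rewrite -subr_eq0; apply/eqP.
  set A := s * a in e b1 *.
  have e3 : s * (1 + (d%:R - 1) * A) * H = (1 + d%:R * A) * (1 - A).
    by rewrite -mulrA e mulrA ss mul1r.
  have e4 : s * (s * H) = H by rewrite mulrA ss mul1r.
  transitivity ((1 + d%:R * A) * (d%:R * (d%:R * (1 + d%:R * A) * H
      - s * (1 - A) * (d%:R + 1) * (1 + d%:R * A) + s * (s * H) * (1 - A)))).
    by field; rewrite D1 b1.
  rewrite e4.
  have -> : d%:R * (1 + d%:R * A) * H - s * (1 - A) * (d%:R + 1) * (1 + d%:R * A)
      + H * (1 - A) = (d%:R + 1) * ((1 + (d%:R - 1) * A) * H
      - s * ((1 + d%:R * A) * (1 - A))) by ring.
  by rewrite e subrr !mulr0.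
- split=> i; first by rewrite formZr nS heq mulrC.
  by rewrite formZr vS mulrC mulrA.
Qed.

End Regular.

(** * Extremal centres *)

Section Extremum.
Local Open Scope classical_set_scope.
Variables (R : realType) (d : nat).
Local Notation pt := 'rV[R]_d.+1.
Implicit Types (K : set pt).

Lemma continuous_add (T : topologicalType) (f g : T -> R^o) :
  continuous f -> continuous g -> continuous (fun x => f x + g x : R^o).
Proof. by move=> fc gc x; apply: cvgD; [exact: fc | exact: gc]. Qed.

Lemma continuous_mul (T : topologicalType) (f g : T -> R^o) :
  continuous f -> continuous g -> continuous (fun x => f x * g x : R^o).
Proof. by move=> fc gc x; apply: cvgM; [exact: fc | exact: gc]. Qed.

Lemma continuous_const (T : topologicalType) (a : R) :
  continuous (fun _ : T => a : R^o).
Proof. exact: cst_continuous. Qed.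

Lemma continuous_bigsum (T : topologicalType) (I : Type) (r : seq I)
    (P : pred I) (f : I -> T -> R^o) :
  (forall i, continuous (f i)) ->
  continuous (fun x => \sum_(i <- r | P i) f i x : R^o).
Proof.
move=> fc; elim: r => [|i r IH].
  by under eq_fun do rewrite big_nil; move=> x; exact: cvg_cst.
have [Pi|/negbTE Pi] := boolP (P i);
  under eq_fun do rewrite big_cons Pi //; last exact: IH.
by move=> x; apply: cvgD; [exact: fc | exact: IH].
Qed.

Lemma continuous_form (s : R) (f g : pt -> pt) :
  continuous f -> continuous g ->
  continuous (fun x => form s (f x) (g x) : R^o).
Proof.
move=> fc gc.
have cc (e : pt -> pt) i : continuous e -> continuous (fun x => e x ord0 i : R^o).
  move=> ec x.
  apply: (@continuous_comp _ _ _ e (fun M : pt => M ord0 i)); first exact: ec.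
  exact: coord_continuous.
apply: (@continuous_add pt).
  apply: (@continuous_mul pt); first exact: (@continuous_const pt).
  by apply: (@continuous_mul pt); exact: cc.
by apply: (@continuous_bigsum pt) => i; apply: (@continuous_mul pt); exact: cc.
Qed.

Lemma compact_coord_bounded K (M : R) : closed K ->
  (forall x, K x -> forall i, `|x ord0 i| <= M) -> compact K.
Proof.
move=> Kc KM.
have Mc := @rV_compact R d.+1 (fun=> `[- M, M]) (fun=> @segment_compact _ _ _).
apply: subclosed_compact Kc Mc _ => x Kx i.
by rewrite /= in_itv /= -ler_norml KM.
Qed.

(** A minimum of finitely many linear functions is continuous, so it attains its maximum on a
    compact set. With vertices for [a] this gives circumcentres, with facet normals spherical
    incentres. *)
Lemma max_min_exists (s : R) K (a : 'I_d.+1 -> pt) : compact K -> K !=set0 ->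
  exists x (m : R), [/\ K x, forall i, m <= form s (a i) x &
    forall y m', K y -> (forall i, m' <= form s (a i) y) -> m' <= m].
Proof.
move=> Kc K0.
(* The default of the minimum is a member of the family, so it does not alter the value. *)
pose F (x : pt) := \big[Num.min/form s (a ord0) x]_i form s (a i) x.
have lc i : continuous (fun x => form s (a i) x : R^o).
  apply: continuous_form => [|x]; last exact: cvg_id.
  exact: (@cst_continuous pt pt).
have Fc : continuous (F : pt -> R^o).
  rewrite /F; elim: (index_enum _) => [|i r IH].
    by under eq_fun do rewrite big_nil; exact: lc.
  by under eq_fun do rewrite big_cons; move=> x;
    apply: continuous_min; [exact: lc | exact: IH].
have [x xK xm] := compact_EVT_max K0 Kc (continuous_subspaceT Fc).
exists x, (F x); split; first by rewrite inE in xK.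
  by move=> i; exact: bigmin_le.
move=> y m' Ky ym; apply: le_trans (xm y _); last by rewrite inE.
by apply: le_bigmin.
Qed.

Lemma sphere_compact : compact [set x : pt | form 1 x x = 1].
Proof.
apply: (@compact_coord_bounded _ 1).
  apply: (@preimage_closed _ _ (fun x : pt => form 1 x x : R^o) [set 1]).
    by move=> x _; apply: continuous_form => y; exact: cvg_id.
  exact: closed_eq.
move=> x /= xx i; rewrite -(ler_pXn2r (ltn0Sn 1)) ?nnegrE // expr1n.
rewrite real_normK ?num_real // -xx -edotE /edot (bigD1 i) //= -expr2 lerDl.
by apply: sumr_ge0 => j _; rewrite -expr2 sqr_ge0.
Qed.

End Extremum.

(** * Hyperbolic simplices *)

Section HyperbolicFunctions.
Variable R : realType.
Implicit Types x y t m : R.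

Lemma coshR2_sinhR2 x : coshR x ^+ 2 - sinhR x ^+ 2 = 1.
Proof. by rewrite /coshR /sinhR expRN; field; rewrite gt_eqF ?expR_gt0. Qed.

Lemma coshR_ge1 x : 1 <= coshR x.
Proof.
have e0 := expR_gt0 x; have := coshR2_sinhR2 x.
have c0 : 0 < coshR x by rewrite divr_gt0 // addr_gt0 // expR_gt0.
by have := sqr_ge0 (sinhR x); nra.
Qed.

Lemma coshR_gt0 x : 0 < coshR x.
Proof. exact: lt_le_trans (coshR_ge1 x). Qed.

Lemma ler_sinhR : {mono @sinhR R : x y / x <= y}.
Proof.
apply: le_mono => x y xy; rewrite /sinhR ltr_pM2r ?invr_gt0 //.
by rewrite ltrD // ?ltrN2 ltr_expR // ltrN2.
Qed.

Lemma sinhR0 : sinhR 0 = 0 :> R.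
Proof. by rewrite /sinhR oppr0 subrr mul0r. Qed.

Lemma sinhR_ge0 x : (0 <= sinhR x) = (0 <= x).
Proof. by rewrite -{1}sinhR0 ler_sinhR. Qed.

Lemma ler_coshR x y : 0 <= x -> 0 <= y -> (coshR x <= coshR y) = (x <= y).
Proof.
move=> x0 y0; rewrite -[RHS]ler_sinhR -(ler_pXn2r (ltn0Sn 1)) ?nnegrE
  ?(ltW (coshR_gt0 _)) //.
rewrite -[RHS](ler_pXn2r (ltn0Sn 1)) ?nnegrE ?sinhR_ge0 //.
have := coshR2_sinhR2 x; have := coshR2_sinhR2 y => hy hx.
by apply/idP/idP; lra.
Qed.

Lemma acoshRK t : 1 <= t -> 0 <= acoshR t /\ coshR (acoshR t) = t.
Proof.
move=> t1; rewrite /acoshR; set s := Num.sqrt _.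
have s0 : 0 <= s by rewrite sqrtr_ge0.
have s2 : s ^+ 2 = t ^+ 2 - 1.
  by rewrite sqr_sqrtr // subr_ge0 -(expr1n _ 2) ler_pXn2r ?nnegrE //; lra.
have E0 : 0 < t + s by lra.
split; first by apply: ln_ge0; lra.
rewrite /coshR expRN lnK ?posrE //.
(* Since [s^2 = t^2 - 1], the product [(t + s) (t - s)] is 1. *)
have -> : (t + s)^-1 = t - s.
  by apply: (mulfI (lt0r_neq0 E0)); rewrite mulfV ?lt0r_neq0 // [RHS]mulrC -subr_sqr s2; ring.
by lra.
Qed.

(** For [m >= 0], [acoshR (sqrt (1 + m^2))] is the inverse hyperbolic sine of [m]. *)
Lemma sinhR_acoshR m : 0 <= m ->
  0 <= acoshR (Num.sqrt (1 + m ^+ 2)) /\ sinhR (acoshR (Num.sqrt (1 + m ^+ 2))) = m.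
Proof.
move=> m0; have h1 : 1 <= Num.sqrt (1 + m ^+ 2).
  by rewrite -{1}sqrtr1 ler_wsqrtr // lerDl sqr_ge0.
have [r0 cr] := acoshRK h1; split=> //.
have := coshR2_sinhR2 (acoshR (Num.sqrt (1 + m ^+ 2))).
rewrite cr sqr_sqrtr ?addr_ge0 ?sqr_ge0 // => e.
have /eqP : sinhR (acoshR (Num.sqrt (1 + m ^+ 2))) ^+ 2 = m ^+ 2 by lra.
by rewrite eqrXn2 ?sinhR_ge0 // => /eqP.
Qed.

End HyperbolicFunctions.

(** * Inclusions between balls and hyperbolic simplices *)

Section Balls.
Local Open Scope classical_set_scope.
Variables (R : realType) (d : nat).
Local Notation pt := 'rV[R]_d.+1.
Implicit Types (c p q x : pt) (v n : 'I_d.+1 -> pt) (h : 'I_d.+1 -> R) (r : R).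

Lemma sup_max (E : set R) r : E r -> ubound E r -> sup E = r.
Proof.
move=> Er Eu; apply/eqP; rewrite eq_le ge_sup //=; last by exists r.
by apply: ub_le_sup => //; exists r.
Qed.

Lemma inf_min (E : set R) r : E r -> lbound E r -> inf E = r.
Proof.
move=> Er El; apply/eqP; rewrite eq_le lb_le_inf ?andbT //; last by exists r.
by apply: ge_inf => //; exists r.
Qed.

Lemma cone_vertex v i : cone v (v i).
Proof.
exists (fun j => (j == i)%:R); split=> [j|]; first exact: ler0n.
rewrite (bigD1 i) //= eqxx scale1r big1 ?addr0 // => j /negbTE ->.
by rewrite scale0r.
Qed.

(** The coefficients of [x] in the vertices are [<n_i, x> / h_i], so the cone is an intersection of
    half-spaces. *)
Lemma cone_facet_normals (s : R) v n h x : facet_normals s v n h ->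
  (forall i, 0 <= form s (n i) x) <-> cone v x.
Proof.
move=> [_ h0 nv e]; split=> [nx|[l [l0 ->]] i].
  exists (fun i => form s (n i) x / h i); split=> // i.
  by rewrite divr_ge0 // ltW.
rewrite form_sumr (bigD1 i) //= formZr nv eqxx big1 ?addr0.
  by rewrite mulr_ge0 // ltW.
by move=> j /negbTE ji; rewrite formZr nv eq_sym ji mulr0.
Qed.

Lemma hball_form c x r : Hd c -> Hd x -> 0 <= r ->
  hdist c x <= r <-> - form (-1) c x <= coshR r.
Proof.
move=> Hc Hx r0; rewrite /hdist ldotE.
have h1 : 1 <= - form (-1) c x by have := Hd_form_le Hc Hx; lra.
by have [a0 ac] := acoshRK h1; rewrite -{2}ac ler_coshR.
Qed.

(** Necessity is tested at the point of the ball moved by [r] straight towards facet [i];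
    sufficiency is Cauchy-Schwarz on the components orthogonal to [c]. *)
Lemma hball_sub_hsimplex v n h c r : facet_normals (-1) v n h ->
  Hd c -> 0 <= r ->
  hball c r `<=` hsimplex v <-> forall i, sinhR r <= form (-1) (n i) c.
Proof.
move=> fn Hc r0; have [nn h0 nv _] := fn; have [cc _] := (Hd_form c).1 Hc.
have C0 := coshR_gt0 r; have CS := coshR2_sinhR2 r.
have S0 : 0 <= sinhR r by rewrite sinhR_ge0.
split=> [sub i|tn x [Hx /(hball_form Hc Hx r0) cx]].
  have [t nc] : exists t, form (-1) (n i) c = t by eexists.
  rewrite nc.
  pose L := Num.sqrt (1 + t ^+ 2).
  have t2 := sqr_ge0 t.
  have L0 : 0 < L by rewrite sqrtr_gt0 ltr_wpDr.
  have L2 : L ^+ 2 = 1 + t ^+ 2 by rewrite sqr_sqrtr // addr_ge0.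
  (* The vector [(n i + t *: c) / L] is the unit tangent at [c] pointing away from the facet. *)
  have [x xE] : exists x, x = coshR r *: c - (sinhR r / L) *: (n i + t *: c).
    by eexists.
  have xc : form (-1) x c = - coshR r.
    by rewrite xE !form_lin nc cc; ring.
  have xx : form (-1) x x = -1.
    rewrite xE !form_lin (formC _ c (n i)) nn nc cc.
    transitivity (- coshR r ^+ 2 + (sinhR r / L) ^+ 2 * (1 + t ^+ 2)); first by ring.
    by rewrite -L2 (expr_div_n (sinhR r)) divfK ?sqrf_eq0 ?lt0r_neq0 //; lra.
  have Hx : Hd x by apply: (Hd_of_form_lt0 Hc xx); rewrite xc oppr_lt0.
  have /sub[_ /(cone_facet_normals _ fn)/(_ i)] : hball c r x.
    by split=> //; apply/hball_form => //; rewrite formC xc opprK.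
  have -> : form (-1) (n i) x = coshR r * t - sinhR r * L.
    rewrite xE !form_lin nn nc.
    have -> : 1 + t * t = L ^+ 2 by rewrite L2; ring.
    by field; exact: lt0r_neq0.
  rewrite subr_ge0 => le1.
  have t0 : 0 <= t.
    by rewrite -(pmulr_rge0 _ C0); apply: le_trans le1; rewrite mulr_ge0 // ltW.
  rewrite -(ler_pXn2r (ltn0Sn 1)) ?nnegrE //.
  have : (sinhR r * L) ^+ 2 <= (coshR r * t) ^+ 2.
    by rewrite ler_pXn2r ?nnegrE //; apply: mulr_ge0 => //; exact: ltW.
  rewrite (exprMn _ (sinhR r)) (exprMn _ (coshR r)) L2.
  have -> : coshR r ^+ 2 = 1 + sinhR r ^+ 2 by lra.
  lra.
split=> //; apply/(cone_facet_normals _ fn) => i.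
have [t nc] : exists t, form (-1) (n i) c = t by eexists.
have tS : sinhR r <= t by rewrite -nc.
have [k kE] : exists k, form (-1) c x = - k.
  by exists (- form (-1) c x); rewrite opprK.
have k1 : 1 <= k by have := Hd_form_le Hc Hx; lra.
have kC : k <= coshR r by lra.
have [xx _] := (Hd_form x).1 Hx.
(* The product of these two vectors is [k t - <n_i, x>], so it suffices that
   [(1 + t^2) (k^2 - 1) <= k^2 t^2], i.e. [k^2 <= 1 + t^2]. *)
have [] := @cauchy_schwarz _ _ (-1) c (- (n i + t *: c)) (x - k *: c)
    (Num.sqrt (1 + t ^+ 2)) (Num.sqrt (k ^+ 2 - 1)) (posdef_orth_hyp Hc).
- by rewrite !form_lin nc cc; ring.
- by rewrite !form_lin (formC _ x c) kE cc; ring.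
- exact: sqrtr_ge0.
- exact: sqrtr_ge0.
- rewrite sqr_sqrtr ?addr_ge0 ?sqr_ge0 // !form_lin (formC _ c (n i)) nn nc cc.
  lra.
- rewrite sqr_sqrtr; last nra.
  rewrite !form_lin (formC _ x c) kE cc xx; lra.
rewrite !form_lin kE nc cc => le1 _.
have t2 := sqr_ge0 t.
have : Num.sqrt (1 + t ^+ 2) * Num.sqrt (k ^+ 2 - 1) <= k * t.
  rewrite -sqrtrM ?addr_ge0 //.
  have kt0 : 0 <= k * t by apply: mulr_ge0; lra.
  rewrite -[leRHS](ger0_norm kt0) -sqrtr_sqr ler_wsqrtr //.
  have : k ^+ 2 <= coshR r ^+ 2 by rewrite ler_pXn2r ?nnegrE //; lra.
  have : sinhR r ^+ 2 <= t ^+ 2 by rewrite ler_pXn2r ?nnegrE //; lra.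
  rewrite (exprMn _ k); lra.
lra.
Qed.

(** For [x = sum_i l_i v_i] in [Hd], [- <x, x> = 1] and [- <v_i, v_j> >= 1] force [sum_i l_i <= 1],
    so bounds at the vertices pass to [x]. As [coshR] is even, the sign of [r] is recorded
    separately. *)
Lemma hsimplex_sub_hball v c r : (forall i, Hd (v i)) -> Hd c ->
  hsimplex v `<=` hball c r <->
  0 <= r /\ forall i, - form (-1) (v i) c <= coshR r.
Proof.
move=> Hv Hc; split=> [sub|[r0 vc] x [Hx [l [l0 xE]]]].
  have vr i : hdist c (v i) <= r.
    by have [] : hball c r (v i) by apply: sub; split; [exact: Hv|exact: cone_vertex].
  have r0 : 0 <= r.
    apply: le_trans (vr ord0); rewrite /hdist ldotE.
    by have [] := @acoshRK R (- form (-1) c (v ord0));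
      have := Hd_form_le Hc (Hv ord0); lra.
  by split=> // i; rewrite formC; apply/hball_form.
split=> //; apply/hball_form => //.
have [xx _] := (Hd_form x).1 Hx.
pose L := \sum_i l i.
have L0 : 0 <= L by apply: sumr_ge0.
have L1 : L ^+ 2 <= 1.
  have -> : 1 = \sum_i \sum_j l i * (l j * - form (-1) (v i) (v j)).
    transitivity (- form (-1) x x); first by lra.
    rewrite {1}xE form_suml -sumrN.
    apply: eq_bigr => i _; rewrite formZl xE form_sumr mulr_sumr -sumrN.
    by apply: eq_bigr => j _; rewrite formZr; ring.
  rewrite expr2 {1}/L mulr_suml; apply: ler_sum => i _.
  rewrite /L mulr_sumr; apply: ler_sum => j _.
  rewrite ler_wpM2l // -{1}[l j]mulr1 ler_wpM2l //.
  by have := Hd_form_le (Hv i) (Hv j); lra.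
have {}L1 : L <= 1 by rewrite -(ler_pXn2r (ltn0Sn 1)) ?nnegrE // expr1n.
rewrite xE form_sumr -sumrN; apply: (@le_trans _ _ (L * coshR r)).
  rewrite /L mulr_suml; apply: ler_sum => i _.
  by rewrite formZr -mulrN ler_wpM2l // formC.
by rewrite -[leRHS]mul1r ler_wpM2r // ltW // coshR_gt0.
Qed.

End Balls.

(** * Hyperbolic incentre, circumcentre and the inequality *)

Section Hyperbolic.
Local Open Scope classical_set_scope.
Variables (R : realType) (d : nat).
Local Notation pt := 'rV[R]_d.+1.
Implicit Types (c p q x y : pt) (v n : 'I_d.+1 -> pt) (h : 'I_d.+1 -> R).

(* Twice [cosh a * cosh b] bounds [cosh (a + b)], so this is a triangle
   inequality through [v]. *)
Lemma Hd_triangle x y (v : pt) : Hd x -> Hd y -> Hd v ->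
  - form (-1) x y <= 2 * (form (-1) x v * form (-1) y v).
Proof.
move=> Hx Hy Hv.
have [xx _] := (Hd_form x).1 Hx; have [yy _] := (Hd_form y).1 Hy.
have [vv _] := (Hd_form v).1 Hv.
have := Hd_form_le Hx Hv; have := Hd_form_le Hy Hv.
have [a aE] : exists a, form (-1) x v = - a by exists (- form (-1) x v); rewrite opprK.
have [b bE] : exists b, form (-1) y v = - b by exists (- form (-1) y v); rewrite opprK.
rewrite aE bE => b1 a1.
have [] := @cauchy_schwarz _ _ (-1) v (- (x - a *: v)) (y - b *: v) a b
  (posdef_orth_hyp Hv).
- by rewrite !form_lin aE vv; ring.
- by rewrite !form_lin bE vv; ring.
- lra.
- lra.
- by rewrite !form_lin (formC _ v x) aE vv xx; lra.
- by rewrite !form_lin (formC _ v y) bE vv yy; lra.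
rewrite !form_lin (formC _ v y) aE bE vv; lra.
Qed.

(** The triangle inequality through [v] bounds the first coordinate, which is the product with the
    base point [e0] up to sign; on the hyperboloid it dominates the other coordinates. *)
Lemma hyp_truncation_compact (v : pt) (M : R) : Hd v ->
  compact [set x : pt | Hd x /\ - M <= form (-1) v x].
Proof.
move=> Hv.
pose e0 : pt := delta_mx ord0 ord0.
have e0E x : form (-1) x e0 = - x ord0 ord0.
  rewrite /form /e0 !mxE !eqxx /= big1 => [|i /negbTE i0]; first by ring.
  by rewrite mxE i0 andbF mulr0.
have He0 : Hd e0 by apply/Hd_form; rewrite e0E /e0 mxE !eqxx.
(* The strict sign condition may be weakened to a closed one, since no point of the hyperboloid has
   first coordinate 0. *)
have -> : [set x : pt | Hd x /\ - M <= form (-1) v x] =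
    ([set x : pt | form (-1) x x = -1] `&` [set x : pt | 0 <= - form (-1) x e0])
     `&` [set x : pt | - M <= form (-1) v x].
  apply/seteqP; split=> x /=.
    by move=> [/Hd_form[xx x0] xM]; rewrite e0E opprK ltW.
  move=> [[xx]]; rewrite e0E opprK => x0 xM; split=> //; apply/Hd_form; split=> //.
  rewrite lt_neqAle x0 andbT; apply: contraPneq xx => z.
  by rewrite form_form0 -z; have := form0_ge0 x; lra.
have idc : continuous (fun x : pt => x) by move=> x; exact: cvg_id.
have cc y : continuous (fun _ : pt => y) by exact: cst_continuous.
apply: (@compact_coord_bounded _ _ _ (2 * M * v ord0 ord0)).
  apply: closedI; first apply: closedI.
  - apply: (@preimage_closed _ _ (fun x : pt => form (-1) x x : R^o) [set -1]).
      by move=> x _; exact: continuous_form.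
    exact: closed_eq.
  - apply: (@preimage_closed _ _ (fun x : pt => form (-1) x e0 : R^o)
      [set t | 0 <= - t]).
      by move=> x _; exact: continuous_form.
    have -> : [set t : R | 0 <= - t] = [set t | t <= 0].
      by apply/seteqP; split=> t /=; rewrite oppr_ge0.
    exact: closed_le.
  - apply: (@preimage_closed _ _ (fun x : pt => form (-1) v x : R^o)
      [set t | - M <= t]).
      by move=> x _; exact: continuous_form.
    exact: closed_ge.
move=> x /= [[xx]]; rewrite e0E opprK => x0 xM i.
have x0p : 0 < x ord0 ord0.
  rewrite lt_neqAle x0 andbT; apply: contraPneq xx => z.
  by rewrite form_form0 -z; have := form0_ge0 x; lra.
have Hx : Hd x by apply/Hd_form.
have x0M : x ord0 ord0 <= 2 * M * v ord0 ord0.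
  have [_ v0] := (Hd_form v).1 Hv.
  have := Hd_triangle Hx He0 Hv.
  rewrite e0E opprK (formC _ e0) e0E (formC _ x v) => le1.
  apply: le_trans le1 _; rewrite -mulrA ler_pM2l // mulrN -mulNr ler_pM2r //.
  lra.
apply: le_trans x0M; rewrite -[leRHS]ger0_norm //.
rewrite -(ler_pXn2r (ltn0Sn 1)) ?nnegrE // !real_normK ?num_real //.
have [->//|i0] := eqVneq i ord0.
move: xx; rewrite /form (bigD1 i) //= -!expr2.
set S := \sum_(_ < _ | _) _.
have : 0 <= S by apply: sumr_ge0 => j _; rewrite -expr2 sqr_ge0.
lra.
Qed.

Section Simplex.
Variables (v n : 'I_d.+1 -> pt) (h : 'I_d.+1 -> R).
Hypotheses (Hv : forall i, Hd (v i)) (fn : facet_normals (-1) v n h).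

(** The incentre is explicit: [w = sum_i v_i / h_i] has product 1 with every normal. If all
    [<n_i, y> >= m'], the coefficients of [y] are at least [m' / h_i], whence
    [1 = - <y, y> >= m'^2 D] because all [- <v_i, v_j>] are positive. *)
Lemma hyp_incenter_exists : exists p (m : R),
  [/\ Hd p, 0 < m, forall i, m <= form (-1) (n i) p &
    forall y m', Hd y -> 0 <= m' -> (forall i, m' <= form (-1) (n i) y) -> m' <= m].
Proof.
have [nn h0 nv e] := fn.
have [w wE] : exists w, w = \sum_i (h i)^-1 *: v i by eexists.
pose D := \sum_i \sum_j (h i)^-1 * ((h j)^-1 * - form (-1) (v i) (v j)).
have vv i j : 1 <= - form (-1) (v i) (v j).
  by have := Hd_form_le (Hv i) (Hv j); lra.
have hV0 i : 0 < (h i)^-1 by rewrite invr_gt0.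
have term0 i j : 0 < (h i)^-1 * ((h j)^-1 * - form (-1) (v i) (v j)).
  by rewrite !mulr_gt0 //; have := vv i j; lra.
have ww : form (-1) w w = - D.
  rewrite {1}wE form_suml -sumrN; apply: eq_bigr => i _.
  rewrite formZl wE form_sumr mulr_sumr -sumrN.
  by apply: eq_bigr => j _; rewrite formZr; ring.
have D0 : 0 < D.
  rewrite /D (bigD1 ord0) //= ltr_wpDr //.
    by apply: sumr_ge0 => i _; apply: sumr_ge0 => j _; exact: ltW.
  rewrite (bigD1 ord0) //= ltr_wpDr //.
  by apply: sumr_ge0 => j _; exact: ltW.
pose N := Num.sqrt D; have N0 : 0 < N by rewrite sqrtr_gt0.
have N2 : N ^+ 2 = D by rewrite sqr_sqrtr // ltW.
have nw i : form (-1) (n i) w = 1.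
  rewrite wE form_sumr (bigD1 i) //= formZr nv eqxx mulVf ?lt0r_neq0 //.
  rewrite big1 ?addr0 // => j /negbTE ji.
  by rewrite formZr nv eq_sym ji mulr0.
have w0 : 0 < w ord0 ord0.
  rewrite wE summxE (bigD1 ord0) //= ltr_wpDr //.
    by apply: sumr_ge0 => i _; rewrite mxE mulr_ge0 ?ltW //;
      have [] := (Hd_form _).1 (Hv i).
  by rewrite mxE mulr_gt0 //; have [] := (Hd_form _).1 (Hv ord0).
exists (N^-1 *: w), N^-1; split.
- apply/Hd_form; rewrite !form_lin ww -N2; split.
    by field; exact: lt0r_neq0.
  by rewrite mxE mulr_gt0 // invr_gt0.
- by rewrite invr_gt0.
- by move=> i; rewrite formZr nw mulr1.
move=> y m' Hy m0 ny.
have [yy _] := (Hd_form y).1 Hy.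
have : m' ^+ 2 * D <= 1.
  have -> : 1 = \sum_i \sum_j (form (-1) (n i) y / h i) *
      ((form (-1) (n j) y / h j) * - form (-1) (v i) (v j)).
    transitivity (- form (-1) y y); first by lra.
    rewrite {1}(e y) form_suml -sumrN; apply: eq_bigr => i _.
    rewrite formZl [in form _ (v i) y](e y) form_sumr mulr_sumr -sumrN.
    by apply: eq_bigr => j _; rewrite formZr; ring.
  rewrite /D mulr_sumr; apply: ler_sum => i _.
  rewrite mulr_sumr; apply: ler_sum => j _.
  have -> : m' ^+ 2 * ((h i)^-1 * ((h j)^-1 * - form (-1) (v i) (v j))) =
      (m' / h i) * ((m' / h j) * - form (-1) (v i) (v j)) by ring.
  have mi k : 0 <= m' / h k by rewrite mulr_ge0 // ltW.
  have ml k : m' / h k <= form (-1) (n k) y / h k by rewrite ler_pM2r.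
  have vv0 : 0 <= - form (-1) (v i) (v j) by have := vv i j; lra.
  by apply: ler_pM => //; [apply: mulr_ge0 | apply: ler_wpM2r].
rewrite -N2 -exprMn => le1.
have : m' * N <= 1.
  by rewrite -(ler_pXn2r (ltn0Sn 1)) ?nnegrE ?expr1n // mulr_ge0 // ltW.
by rewrite -ler_pdivlMr // div1r.
Qed.

(** The search is restricted to a compact truncation around [v ord0]. A centre outside it has bound
    above [M], while [v ord0] itself achieves [M]. *)
Lemma hyp_circumcenter_exists : exists q (k : R),
  [/\ Hd q, 1 <= k, forall i, - form (-1) (v i) q <= k &
    forall y k', Hd y -> (forall i, - form (-1) (v i) y <= k') -> k <= k'].
Proof.
pose M := \sum_i - form (-1) (v ord0) (v i).
have M0 i : 0 <= - form (-1) (v ord0) (v i).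
  by have := Hd_form_le (Hv ord0) (Hv i); lra.
have Mi i : - form (-1) (v ord0) (v i) <= M.
  by rewrite /M (bigD1 i) //= lerDl sumr_ge0.
have [|q [m [[Hq _] vq qm]]] := max_min_exists (-1) v
    (hyp_truncation_compact (M:=M) (Hv ord0)).
  by exists (v ord0); split; [exact: Hv | rewrite lerNl].
exists q, (- m); split=> //.
- by have := vq ord0; have := Hd_form_le (Hv ord0) Hq; lra.
- by move=> i; rewrite lerN2.
move=> y k' Hy yk.
have [kM|Mk] := leP k' M.
  rewrite lerNl; apply: (qm y) => [|i]; last by rewrite lerNl.
  by split=> //; rewrite lerNl; exact: le_trans kM.
apply: le_trans (ltW Mk); rewrite lerNl; apply: (qm (v ord0)) => [|i].
  by split; [exact: Hv | rewrite lerNl].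
by rewrite formC lerNl.
Qed.

(** The max-min value [m] is [sinh] of the inradius. *)
Lemma h_irE p (m : R) : Hd p -> 0 < m -> (forall i, m <= form (-1) (n i) p) ->
  (forall y m', Hd y -> 0 <= m' -> (forall i, m' <= form (-1) (n i) y) -> m' <= m) ->
  tanhR (h_ir (hsimplex v)) = m / Num.sqrt (1 + m ^+ 2).
Proof.
move=> Hp m0 mn mmax; have [r0 rE] := sinhR_acoshR (ltW m0).
have c1 : 1 <= Num.sqrt (1 + m ^+ 2).
  by rewrite -{1}sqrtr1 ler_wsqrtr // lerDl sqr_ge0.
have [_ cE] := acoshRK c1.
suff -> : h_ir (hsimplex v) = acoshR (Num.sqrt (1 + m ^+ 2)).
  by rewrite /tanhR rE cE.
apply: sup_max.
  split=> //; exists p; split=> //.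
  by apply/(hball_sub_hsimplex fn Hp r0) => i; rewrite rE.
move=> r /= [r0' [c [Hc /(hball_sub_hsimplex fn Hc r0') nc]]].
by rewrite -ler_sinhR rE; apply: (mmax c) => //; rewrite sinhR_ge0.
Qed.

Lemma h_cirrE q (k : R) : Hd q -> 1 <= k -> (forall i, - form (-1) (v i) q <= k) ->
  (forall y k', Hd y -> (forall i, - form (-1) (v i) y <= k') -> k <= k') ->
  tanhR (h_cirr (hsimplex v)) = Num.sqrt (k ^+ 2 - 1) / k.
Proof.
move=> Hq k1 kv kmin; have [r0 cE] := acoshRK k1.
suff -> : h_cirr (hsimplex v) = acoshR k.
  rewrite /tanhR cE; congr (_ / _).
  have := coshR2_sinhR2 (acoshR k); rewrite cE => <-.
  rewrite opprB addrC subrK sqrtr_sqr ger0_norm // sinhR_ge0 //.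
apply: inf_min.
  by exists q; split=> //; apply/(hsimplex_sub_hball _ Hv Hq); rewrite cE.
move=> r /= [c [Hc /(hsimplex_sub_hball _ Hv Hc)[r0' vc]]].
by rewrite -ler_coshR // cE; exact: (kmin c).
Qed.

End Simplex.

Theorem hyp_simplex_tanh v : (2 <= d)%N -> is_hyp_simplex v ->
  tanhR (h_cirr (hsimplex v)) >= d%:R * tanhR (h_ir (hsimplex v)) /\
  (tanhR (h_cirr (hsimplex v)) = d%:R * tanhR (h_ir (hsimplex v))
     <-> h_regular v).
Proof.
move=> d2 [Hv vi].
have [|i x x0 xv|n [h fn]] := facet_normals_exist (s := -1) _ vi; first by ring.
  (* A vector orthogonal to the facet opposite to [v i] is orthogonal to some vertex, hence
     spacelike. *)
  have [j ji] := other_index i d2.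
  have [ge0 eq0] := posdef_orth_hyp (Hv j) (xv j ji).
  by rewrite lt_neqAle ge0 andbT eq_sym; apply: contra x0 => /eqP/eq0 ->.
have [p [m [Hp m0 mn mmax]]] := hyp_incenter_exists Hv fn.
have [q [k [Hq k1 kv kmin]]] := hyp_circumcenter_exists Hv.
rewrite (h_irE fn Hp m0 mn mmax) (h_cirrE Hv Hq k1 kv kmin).
have k0 : 0 < k by lra.
have m2 := sqr_ge0 m.
have k2 : 0 <= k ^+ 2 - 1 by rewrite subr_ge0 -(expr1n _ 2) ler_pXn2r ?nnegrE // ltW.
set C := Num.sqrt (1 + m ^+ 2); set W := Num.sqrt _ / k.
have C0 : 0 < C by rewrite sqrtr_gt0 ltr_wpDr.
have C2 : C ^+ 2 = 1 + m ^+ 2 by rewrite sqr_sqrtr // addr_ge0.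
pose Y := C / m; have Y0 : 0 < Y by rewrite divr_gt0.
have W0 : 0 <= W by rewrite divr_ge0 ?sqrtr_ge0 // ltW.
have eY : m ^+ 2 * Y ^+ 2 = 1 + m ^+ 2.
  by rewrite -exprMn /Y mulrCA mulfV ?mulr1 // lt0r_neq0.
have eW : k ^+ 2 * W ^+ 2 = k ^+ 2 - 1.
  rewrite -exprMn /W mulrCA mulfV ?mulr1 ?sqr_sqrtr //; exact: lt0r_neq0.
have [le1 eq1] := hyp_core d2 fn Hv Hp Hq m0 k0 (ltW Y0) W0 eY eW mn kv.
have mC : m / C = Y^-1 by rewrite /Y invf_div.
rewrite mC; split; first by rewrite ler_pdivrMr // mulrC.
have products : W = d%:R / Y <-> Y * W = d%:R.
  split=> [->|<-]; first by rewrite mulrCA mulfV ?mulr1 // lt0r_neq0.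
  by rewrite mulrAC mulfV ?mul1r // lt0r_neq0.
rewrite products; split=> [/eq1 vE i j i' j' ij ij'|reg].
  by rewrite /hdist !ldotE (vE i j i' j').
have vv i : form (-1) (v i) (v i) = -1 by have [] := (Hd_form (v i)).1 (Hv i).
have [i1 i10] := other_index (ord0 : 'I_d.+1) d2.
pose a := form (-1) (v i1) (v ord0).
have a1 : a <= -1 by exact: Hd_form_le.
have va i j : i != j -> form (-1) (v i) (v j) = a.
  move=> ij; have := congr1 (@coshR R) (reg i j i1 ord0 ij i10).
  rewrite /hdist !ldotE.
  have := Hd_form_le (Hv i) (Hv j) => b1.
  have [_ ->] := @acoshRK R (- form (-1) (v i) (v j)) ltac:(lra).
  have [_ ->] := @acoshRK R (- form (-1) (v i1) (v ord0)) ltac:(rewrite -/a; lra).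
  by rewrite -/a; lra.
have apos : 0 < 1 + d%:R * (-1 * a).
  by rewrite ltr_wpDr // mulr_ge0 //; lra.
(* The barycentre is a competitor for both extremal problems, so [m' <= m] and [k <= k']. The
   identity for [m'] and [k'] then bounds [Y W] by [d], the reverse of [le1]. *)
have [p' [m' [k' [pp' m'0 k'0 e' [np' vp']]]]] :=
  regular_core d2 (etrans (mulrN1 _) (opprK 1)) fn vv va apos.
have Hp' : Hd p'.
  apply: (Hd_of_form_lt0 (Hv ord0) pp'); rewrite formC vp'; lra.
have m'm : m' <= m by apply: (mmax p') => // [|i]; rewrite ?np' // ltW.
have kk' : k <= k' by apply: (kmin p') => // i; rewrite vp'; lra.
apply/eqP; rewrite eq_le le1 andbT.
have d0 : 0 <= d%:R :> R by [].
have YW0 : 0 <= Y * W by rewrite mulr_ge0 // ltW.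
rewrite -(ler_pXn2r (ltn0Sn 1)) ?nnegrE // (exprMn _ Y).
have mm2 : m' ^+ 2 <= m ^+ 2 by rewrite ler_pXn2r ?nnegrE // ltW.
have kk2 : k ^+ 2 <= k' ^+ 2 by rewrite ler_pXn2r ?nnegrE // ltW.
have Y2 : Y ^+ 2 = 1 + m^-2.
  apply: (mulfI (lt0r_neq0 (exprn_gt0 2 m0))).
  by rewrite eY mulrDr mulr1 mulfV 1?addrC // lt0r_neq0 // exprn_gt0.
have W2 : W ^+ 2 = 1 - k^-2.
  apply: (mulfI (lt0r_neq0 (exprn_gt0 2 k0))).
  by rewrite eW mulrBr mulr1 mulfV // lt0r_neq0 // exprn_gt0.
have -> : d%:R ^+ 2 = (1 + m'^-2) * (1 - k'^-2).
  apply: (mulIf (lt0r_neq0 (mulr_gt0 (exprn_gt0 2 m'0) (exprn_gt0 2 k'0)))).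
  by rewrite e'; field; rewrite !lt0r_neq0.
rewrite Y2 W2; apply: ler_pM.
- by rewrite -Y2 sqr_ge0.
- by rewrite -W2 sqr_ge0.
- by rewrite lerD2l lef_pV2 ?posrE ?exprn_gt0.
- by rewrite lerD2l lerN2 lef_pV2 ?posrE ?exprn_gt0.
Qed.

End Hyperbolic.

(** * Spherical simplices *)

Section Spherical.
Local Open Scope classical_set_scope.
Variables (R : realType) (d : nat).
Local Notation pt := 'rV[R]_d.+1.
Implicit Types (c p q x y : pt) (v n : 'I_d.+1 -> pt) (h : 'I_d.+1 -> R) (r : R).

Lemma ler_cos_pi r s : 0 <= r <= pi -> 0 <= s <= pi -> (cos r <= cos s) = (s <= r).
Proof. by move=> rI sI; rewrite !leNgt ltr_cos // in_itv. Qed.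

Lemma ler_sin_pihalf r s : 0 <= r <= pi / 2 -> 0 <= s <= pi / 2 ->
  (sin r <= sin s) = (r <= s).
Proof.
have p0 := pi_gt0 R.
by move=> rI sI; rewrite !leNgt ltr_sin // in_itv /=; lra.
Qed.

Lemma Sd_form x : Sd x <-> form 1 x x = 1.
Proof. by rewrite /Sd /mkset edotE. Qed.

Lemma Sd_form_itv x y : Sd x -> Sd y -> -1 <= form 1 x y <= 1.
Proof.
move=> /Sd_form xx /Sd_form yy.
have [le1 _] := sph_le1 xx yy.
have xx' : form 1 (- x) (- x) = 1 by rewrite !form_lin opprK.
have [] := sph_le1 xx' yy; rewrite formNl; lra.
Qed.

Lemma sball_form c x r : Sd c -> Sd x -> 0 <= r <= pi ->
  sdist c x <= r <-> cos r <= form 1 c x.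
Proof.
move=> Sc Sx rI; have cI := Sd_form_itv Sc Sx; rewrite /sdist edotE.
rewrite -{2}(acosK (x := form 1 c x)) ?in_itv //.
by rewrite ler_cos_pi // acos_ge0 // acos_lepi.
Qed.

Lemma pos_lower_bound (f : 'I_d.+1 -> R) : (forall i, 0 < f i) ->
  exists2 e, 0 < e & forall i, e <= f i.
Proof.
move=> f0; exists (\big[Num.min/1]_i f i); first by apply: lt_bigmin.
by move=> i; exact: bigmin_le.
Qed.

(** As in hyperbolic space, the test point is [c] moved by [r] towards facet [i]. *)
Lemma sball_sub_facets v n h c r : facet_normals 1 v n h ->
  Sd c -> 0 <= r <= pi / 2 -> sball c r `<=` ssimplex v ->
  forall i, sin r <= form 1 (n i) c.
Proof.
move=> fn Sc rI sub i; have [nn h0 nv _] := fn; have cc := (Sd_form c).1 Sc.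
have p0 := pi_gt0 R.
have C0 : 0 <= cos r by apply: cos_ge0_pihalf; lra.
have S0 : 0 <= sin r by apply: sin_ge0_pi; lra.
have CS := cos2Dsin2 r.
have rpi : 0 <= r <= pi by lra.
have [t nc] : exists t, form 1 (n i) c = t by eexists.
(* The sign is read off at [c] itself, because [cos r] may vanish. *)
have t0 : 0 <= t.
  have /sub[_ /(cone_facet_normals _ fn)/(_ i)] : sball c r c; last by rewrite nc.
  by split=> //; apply/sball_form => //; rewrite cc; exact: cos_le1.
(* For [t = 1] the centre is [n i] and there is no direction towards the facet. *)
rewrite nc; have [t1|t1] := leP 1 t; first by have := sin_le1 r; lra.
pose L := Num.sqrt (1 - t ^+ 2).
have t2 : 0 < 1 - t ^+ 2 by nra.
have L0 : 0 < L by rewrite sqrtr_gt0.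
have L2 : L ^+ 2 = 1 - t ^+ 2 by rewrite sqr_sqrtr // ltW.
have [x xE] : exists x, x = cos r *: c - (sin r / L) *: (n i - t *: c) by eexists.
have xc : form 1 x c = cos r by rewrite xE !form_lin nc cc; ring.
have xx : form 1 x x = 1.
  rewrite xE !form_lin (formC _ c (n i)) nn nc cc.
  transitivity (cos r ^+ 2 + (sin r / L) ^+ 2 * (1 - t ^+ 2)); first by ring.
  by rewrite -L2 (expr_div_n (sin r)) divfK ?sqrf_eq0 ?lt0r_neq0 //; lra.
have Sx : Sd x by apply/Sd_form.
have /sub[_ /(cone_facet_normals _ fn)/(_ i)] : sball c r x.
  by split=> //; apply/sball_form => //; rewrite formC xc.
have -> : form 1 (n i) x = cos r * t - sin r * L.
  rewrite xE !form_lin nn nc.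
  have -> : 1 - t * t = L ^+ 2 by rewrite L2; ring.
  by field; exact: lt0r_neq0.
rewrite subr_ge0 => le1.
rewrite -(ler_pXn2r (ltn0Sn 1)) ?nnegrE //.
have : (sin r * L) ^+ 2 <= (cos r * t) ^+ 2.
  by rewrite ler_pXn2r ?nnegrE //; apply: mulr_ge0 => //; exact: ltW.
rewrite (exprMn _ (sin r)) (exprMn _ (cos r)) L2.
have -> : cos r ^+ 2 = 1 - sin r ^+ 2 by lra.
lra.
Qed.

(** Otherwise all normals would equal [c], although only one of them has nonzero product with a
    given vertex. *)
Lemma facet_normals_lt1 v n h c (m : R) : (2 <= d)%N -> facet_normals 1 v n h ->
  Sd c -> (forall i, m <= form 1 (n i) c) -> m < 1.
Proof.
move=> d2 [nn h0 nv _] Sc mn; rewrite ltNge; apply/negP => m1.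
have nE i : n i = c.
  have [le1 eq1] := sph_le1 (nn i) ((Sd_form c).1 Sc).
  by apply: eq1; have := mn i; lra.
have [j ji] := other_index (ord0 : 'I_d.+1) d2.
have := nv j ord0; rewrite (negbTE ji) nE -(nE ord0) nv eqxx.
by have := h0 ord0; lra.
Qed.

(** A ball of radius at least [pi / 2] would contain one of radius exactly [pi / 2], giving
    [<n_i, c> >= 1] for all [i]. This keeps [r] where [sin] is increasing. *)
Lemma sball_sub_ssimplex v n h c r : (2 <= d)%N -> facet_normals 1 v n h ->
  Sd c -> 0 <= r ->
  sball c r `<=` ssimplex v <->
  r < pi / 2 /\ forall i, sin r <= form 1 (n i) c.
Proof.
move=> d2 fn Sc r0; have [nn h0 nv _] := fn; have cc := (Sd_form c).1 Sc.
have p0 := pi_gt0 R.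
split=> [sub|[rp tn] x [Sx]].
  have [rp|pr] := ltP r (pi / 2).
    by split=> //; apply: (sball_sub_facets fn Sc _ sub); rewrite r0 ltW.
  have sub' : sball c (pi / 2) `<=` ssimplex v.
    by move=> x [Sx cx]; apply: sub; split=> //; exact: le_trans pr.
  have pI : 0 <= (pi : R) / 2 <= (pi : R) / 2 by lra.
  have := sball_sub_facets fn Sc pI sub'; rewrite sin_pihalf.
  by move=> /(facet_normals_lt1 d2 fn Sc); rewrite ltxx.
have rI : 0 <= r <= pi by lra.
have C0 : 0 <= cos r by apply: cos_ge0_pihalf; lra.
have S0 : 0 <= sin r by apply: sin_ge0_pi.
have CS := cos2Dsin2 r.
move=> /(sball_form Sc Sx rI) cx.
split=> //; apply/(cone_facet_normals _ fn) => i.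
have [t nc] : exists t, form 1 (n i) c = t by eexists.
have tS : sin r <= t by rewrite -nc.
have t1 : t <= 1.
  by have := Sd_form_itv ((Sd_form _).2 (nn i)) Sc; rewrite nc; lra.
have [k kE] : exists k, form 1 c x = k by eexists.
have k1 : k <= 1 by have := Sd_form_itv Sc Sx; rewrite kE; lra.
have kC : cos r <= k by rewrite -kE.
have xx := (Sd_form x).1 Sx.
have t2 : 0 <= 1 - t ^+ 2 by nra.
have k2 : 0 <= 1 - k ^+ 2 by nra.
have [] := @cauchy_schwarz _ _ 1 c (- (n i - t *: c)) (x - k *: c)
    (Num.sqrt (1 - t ^+ 2)) (Num.sqrt (1 - k ^+ 2)) (@posdef_orth_sph _ _ _).
- by rewrite !form_lin nc cc; ring.
- by rewrite !form_lin (formC _ x c) kE cc; ring.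
- exact: sqrtr_ge0.
- exact: sqrtr_ge0.
- by rewrite sqr_sqrtr // !form_lin (formC _ c (n i)) nn nc cc; lra.
- by rewrite sqr_sqrtr // !form_lin (formC _ x c) kE cc xx; lra.
rewrite !form_lin kE nc cc => le1 _.
have : Num.sqrt (1 - t ^+ 2) * Num.sqrt (1 - k ^+ 2) <= k * t.
  rewrite -sqrtrM //.
  have kt0 : 0 <= k * t by apply: mulr_ge0; lra.
  rewrite -[leRHS](ger0_norm kt0) -sqrtr_sqr ler_wsqrtr //.
  have : cos r ^+ 2 <= k ^+ 2 by rewrite ler_pXn2r ?nnegrE //; lra.
  have : sin r ^+ 2 <= t ^+ 2 by rewrite ler_pXn2r ?nnegrE //; lra.
  rewrite (exprMn _ k); lra.
lra.
Qed.

(** Now [<v_i, v_j> <= 1] makes the coefficients sum to at least 1; since [cos r >= 0], the vertex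
    bounds pass to the simplex. *)
Lemma ssimplex_sub_sball v c r : (forall i, Sd (v i)) -> Sd c ->
  0 <= r <= pi / 2 -> (forall i, cos r <= form 1 (v i) c) ->
  ssimplex v `<=` sball c r.
Proof.
move=> Sv Sc rI vc x [Sx [l [l0 xE]]].
have p0 := pi_gt0 R; have rpi : 0 <= r <= pi by lra.
have C0 : 0 <= cos r by apply: cos_ge0_pihalf; lra.
split=> //; apply/sball_form => //.
have xx := (Sd_form x).1 Sx.
pose L := \sum_i l i.
have L0 : 0 <= L by apply: sumr_ge0.
have L1 : 1 <= L ^+ 2.
  have -> : 1 = \sum_i \sum_j l i * (l j * form 1 (v i) (v j)).
    transitivity (form 1 x x); first by [].
    rewrite {1}xE form_suml; apply: eq_bigr => i _.
    rewrite formZl xE form_sumr mulr_sumr.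
    by apply: eq_bigr => j _; rewrite formZr.
  rewrite expr2 {1}/L mulr_suml; apply: ler_sum => i _.
  rewrite /L mulr_sumr; apply: ler_sum => j _.
  rewrite ler_wpM2l // -[leRHS]mulr1 ler_wpM2l //.
  by have := Sd_form_itv (Sv i) (Sv j); lra.
have {}L1 : 1 <= L by rewrite -(ler_pXn2r (ltn0Sn 1)) ?nnegrE // expr1n.
rewrite xE form_sumr; apply: (@le_trans _ _ (L * cos r)).
  by rewrite -[leLHS]mul1r ler_wpM2r.
rewrite /L mulr_suml; apply: ler_sum => i _.
by rewrite formZr ler_wpM2l // formC.
Qed.

(** The guard [r <= pi] is there because [cos] no longer orders radii beyond [pi]. *)
Lemma ssimplex_sub_sball_vertices v c r : (forall i, Sd (v i)) -> Sd c ->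
  ssimplex v `<=` sball c r ->
  0 <= r /\ (r <= pi -> forall i, cos r <= form 1 (v i) c).
Proof.
move=> Sv Sc sub.
have vr i : sdist c (v i) <= r.
  by have [] : sball c r (v i) by apply: sub; split; [exact: Sv|exact: cone_vertex].
have r0 : 0 <= r.
  apply: le_trans (vr ord0); rewrite /sdist edotE.
  by apply: acos_ge0; exact: Sd_form_itv.
by split=> // rp i; rewrite formC; apply/sball_form => //; rewrite r0.
Qed.

Lemma sph_normalize y : 0 < form 1 y y -> Sd ((Num.sqrt (form 1 y y))^-1 *: y).
Proof.
move=> y0; set N := Num.sqrt _.
have N0 : 0 < N by rewrite sqrtr_gt0.
apply/Sd_form; rewrite !form_lin.
have -> : form 1 y y = N ^+ 2 by rewrite sqr_sqrtr // ltW.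
by field; exact: lt0r_neq0.
Qed.

(** Normalising [u] gives a point of the sphere where the minimum is positive, so the maximal
    minimum is positive too. *)
Lemma sph_max_min_pos (a : 'I_d.+1 -> pt) u : (forall i, 0 < form 1 (a i) u) ->
  exists p (m : R), [/\ Sd p, 0 < m, forall i, m <= form 1 (a i) p &
    forall y m', Sd y -> (forall i, m' <= form 1 (a i) y) -> m' <= m].
Proof.
move=> au.
have u0 : 0 < form 1 u u.
  rewrite lt_neqAle form1_ge0 andbT; apply/eqP => /esym/form1_eq0 uz.
  by have := au ord0; rewrite uz form0r ltxx.
pose w := (Num.sqrt (form 1 u u))^-1 *: u.
have Sw : Sd w := sph_normalize u0.
have [|p [m [Sp mp mm]]] := max_min_exists 1 a (@sphere_compact R d).
  by exists w; apply/Sd_form.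
have aw i : 0 < form 1 (a i) w.
  by rewrite /w formZr mulr_gt0 // invr_gt0 sqrtr_gt0.
have [e e0 ea] := pos_lower_bound aw.
exists p, m; split=> //.
- exact/Sd_form.
- by apply: lt_le_trans e0 _; apply: (mm w) => //; exact/Sd_form.
- by move=> y m' /Sd_form Sy; exact: mm.
Qed.

Lemma tan_sqrt r : 0 < cos r -> 0 <= sin r ->
  tan r = sin r / Num.sqrt (1 - sin r ^+ 2) /\
  tan r = Num.sqrt (1 - cos r ^+ 2) / cos r.
Proof.
move=> c0 s0; rewrite /tan; have CS := cos2Dsin2 r.
have -> : 1 - sin r ^+ 2 = cos r ^+ 2 by lra.
have -> : 1 - cos r ^+ 2 = sin r ^+ 2 by lra.
by rewrite !sqrtr_sqr !ger0_norm // ltW.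
Qed.

(** * Inradius and circumradius of a spherical simplex *)

Section Simplex.
Variables (v n : 'I_d.+1 -> pt) (h : 'I_d.+1 -> R).
Hypotheses (d2 : (2 <= d)%N) (Sv : forall i, Sd (v i)).
Hypothesis fn : facet_normals 1 v n h.

Lemma s_irE p (m : R) : Sd p -> 0 < m -> (forall i, m <= form 1 (n i) p) ->
  (forall y m', Sd y -> (forall i, m' <= form 1 (n i) y) -> m' <= m) ->
  tan (s_ir (ssimplex v)) = m / Num.sqrt (1 - m ^+ 2).
Proof.
move=> Sp m0 mn mmax; have m1 := facet_normals_lt1 d2 fn Sp mn.
have p0 := pi_gt0 R.
have mI : -1 <= m <= 1 by lra.
have sE : sin (asin m) = m by rewrite asinK // in_itv.
have r0 : 0 <= asin m.
  rewrite leNgt; apply/negP => r0.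
  have := asin_geNpi2 mI => r1.
  have : 0 <= sin (- asin m) by apply: sin_ge0_pi; lra.
  by rewrite sinN sE; lra.
have rp : asin m < pi / 2 by apply: asin_ltpi2; lra.
suff -> : s_ir (ssimplex v) = asin m.
  have [|| -> _] := @tan_sqrt (asin m); last by rewrite sE.
    by apply: cos_gt0_pihalf; lra.
  by rewrite sE ltW.
apply: sup_max.
  split=> //; exists p; split=> //; apply/(sball_sub_ssimplex d2 fn Sp r0).
  by split=> // i; rewrite sE.
move=> r /= [r0' [c [Sc /(sball_sub_ssimplex d2 fn Sc r0')[rp' nc]]]].
by rewrite -ler_sin_pihalf ?r0 ?r0' ?(ltW rp) ?(ltW rp') // sE; exact: (mmax c).
Qed.

Lemma s_cirrE q (k : R) : Sd q -> 0 < k -> (forall i, k <= form 1 (v i) q) ->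
  (forall y k', Sd y -> (forall i, k' <= form 1 (v i) y) -> k' <= k) ->
  tan (s_cirr (ssimplex v)) = Num.sqrt (1 - k ^+ 2) / k.
Proof.
move=> Sq k0 kv kmax; have p0 := pi_gt0 R.
have k1 : k <= 1 by have := Sd_form_itv (Sv ord0) Sq; have := kv ord0; lra.
have kI : -1 <= k <= 1 by lra.
have cE : cos (acos k) = k by rewrite acosK // in_itv.
have r0 : 0 <= acos k := acos_ge0 kI.
have rpi : acos k <= pi := acos_lepi kI.
have rp : acos k <= pi / 2.
  have pI : 0 <= (pi : R) / 2 <= pi by lra.
  by rewrite -(ler_cos_pi pI) ?r0 // cE cos_pihalf ltW.
suff -> : s_cirr (ssimplex v) = acos k.
  have [|| _ ->] := @tan_sqrt (acos k); last by rewrite cE.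
    by rewrite cE.
  by apply: sin_ge0_pi; rewrite r0.
apply: inf_min.
  by exists q; split=> //; apply: ssimplex_sub_sball => // [|i]; rewrite ?r0 ?cE.
move=> r /= [c [Sc /(ssimplex_sub_sball_vertices Sv Sc)[r0' vc]]].
(* A radius above [pi] exceeds [acos k] in any case. *)
have [rp'|/ltW] := leP r pi; last exact: le_trans.
by rewrite -ler_cos_pi ?r0 ?r0' // cE; apply: (kmax c) => //; exact: vc.
Qed.

End Simplex.

Theorem sph_simplex_tan v : (2 <= d)%N -> is_sph_simplex v ->
  tan (s_cirr (ssimplex v)) >= d%:R * tan (s_ir (ssimplex v)) /\
  (tan (s_cirr (ssimplex v)) = d%:R * tan (s_ir (ssimplex v))
     <-> s_regular v).
Proof.
move=> d2 [Sv [[u uv] vi]].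
have [|i x x0 _|n [h fn]] := facet_normals_exist (s := 1) _ vi; first by ring.
  rewrite lt_neqAle form1_ge0 andbT eq_sym.
  by apply: contra x0 => /eqP/form1_eq0 ->.
have [nn h0 nv _] := fn.
have vv i : form 1 (v i) (v i) = 1 by apply/Sd_form.
have nS i : form 1 (n i) (\sum_j v j) = h i.
  rewrite form_sumr (bigD1 i) //= nv eqxx big1 ?addr0 // => j ji.
  by rewrite nv eq_sym (negbTE ji).
have [p [m [Sp m0 mn mmax]]] : exists p (m : R),
    [/\ Sd p, 0 < m, forall i, m <= form 1 (n i) p &
    forall y m', Sd y -> (forall i, m' <= form 1 (n i) y) -> m' <= m].
  by apply: (sph_max_min_pos (u := \sum_j v j)) => i; rewrite nS.
have [q [k [Sq k0 kv kmax]]] : exists q (k : R),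
    [/\ Sd q, 0 < k, forall i, k <= form 1 (v i) q &
    forall y k', Sd y -> (forall i, k' <= form 1 (v i) y) -> k' <= k].
  by apply: (sph_max_min_pos (u := u)) => i; rewrite formC -edotE.
rewrite (s_irE d2 fn Sp m0 mn mmax) (s_cirrE Sv Sq k0 kv kmax).
have m1 := facet_normals_lt1 d2 fn Sp mn.
have k1 : k <= 1 by have := Sd_form_itv (Sv ord0) Sq; have := kv ord0; lra.
have m2 : 0 < 1 - m ^+ 2 by nra.
have k2 : 0 <= 1 - k ^+ 2 by nra.
set C := Num.sqrt (1 - m ^+ 2); set W := Num.sqrt _ / k.
have C0 : 0 < C by rewrite sqrtr_gt0.
have C2 : C ^+ 2 = 1 - m ^+ 2 by rewrite sqr_sqrtr // ltW.
pose Y := C / m; have Y0 : 0 < Y by rewrite divr_gt0.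
have W0 : 0 <= W by rewrite divr_ge0 ?sqrtr_ge0 // ltW.
have eY : m ^+ 2 * Y ^+ 2 = 1 - m ^+ 2.
  by rewrite -exprMn /Y mulrCA mulfV ?mulr1 // lt0r_neq0.
have eW : k ^+ 2 * W ^+ 2 = 1 - k ^+ 2.
  rewrite -exprMn /W mulrCA mulfV ?mulr1 ?sqr_sqrtr //; exact: lt0r_neq0.
have [le1 eq1] := sph_core d2 fn vv ((Sd_form _).1 Sp) ((Sd_form _).1 Sq)
  m0 k0 (ltW Y0) W0 eY eW mn kv.
have mC : m / C = Y^-1 by rewrite /Y invf_div.
rewrite mC; split; first by rewrite ler_pdivrMr // mulrC.
have products : W = d%:R / Y <-> Y * W = d%:R.
  split=> [->|<-]; first by rewrite mulrCA mulfV ?mulr1 // lt0r_neq0.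
  by rewrite mulrAC mulfV ?mul1r // lt0r_neq0.
rewrite products; split=> [/eq1 vE i j i' j' ij ij'|reg].
  by rewrite /sdist !edotE (vE i j i' j').
have [i1 i10] := other_index (ord0 : 'I_d.+1) d2.
pose a := form 1 (v i1) (v ord0).
have va i j : i != j -> form 1 (v i) (v j) = a.
  move=> ij; have := congr1 (@cos R) (reg i j i1 ord0 ij i10).
  by rewrite /sdist !edotE !acosK // in_itv /=; exact: Sd_form_itv.
(* The vertex sum has square [(d + 1) (1 + d a)] and is nonzero, since its product with [n ord0] is
   [h ord0]. *)
have apos : 0 < 1 + d%:R * (1 * a).
  have SS : form 1 (\sum_j v j) (\sum_j v j) = d.+1%:R * (1 + d%:R * (1 * a)).
    rewrite {1}form_suml (eq_bigr (fun=> 1 + d%:R * (1 * a))).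
      by rewrite sumr_const card_ord -[LHS]mulr_natl.
    move=> i _; rewrite form_sumr (bigD1 i) //= vv (eq_bigr (fun=> a)).
      by rewrite sumr_const cardC1 card_ord /= -[a *+ d]mulr_natl mul1r.
    by move=> j ji; rewrite va // eq_sym.
  rewrite -(pmulr_rgt0 _ (ltr0Sn R d)) -SS lt_neqAle form1_ge0 andbT.
  apply/eqP => /esym/form1_eq0 S0; have := h0 ord0.
  by rewrite -nS S0 form0r ltxx.
(* The barycentre competes in both maximisations, so [m' <= m] and [k' <= k], which yields
   [Y W <= d]. *)
have [p' [m' [k' [pp' m'0 k'0 e' [np' vp']]]]] :=
  regular_core d2 (mulr1 1) fn vv va apos.
have Sp' : Sd p' by apply/Sd_form.
have m'm : m' <= m by apply: (mmax p') => // i; rewrite np'.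
have kk' : k' <= k by apply: (kmax p') => // i; rewrite vp' mul1r.
apply/eqP; rewrite eq_le le1 andbT.
have YW0 : 0 <= Y * W by rewrite mulr_ge0 // ltW.
rewrite -(ler_pXn2r (ltn0Sn 1)) ?nnegrE // (exprMn _ Y).
have mm2 : m' ^+ 2 <= m ^+ 2 by rewrite ler_pXn2r ?nnegrE // ltW.
have kk2 : k' ^+ 2 <= k ^+ 2 by rewrite ler_pXn2r ?nnegrE // ltW.
have Y2 : Y ^+ 2 = m^-2 - 1.
  apply: (mulfI (lt0r_neq0 (exprn_gt0 2 m0))).
  by rewrite eY mulrBr mulr1 mulfV // lt0r_neq0 // exprn_gt0.
have W2 : W ^+ 2 = k^-2 - 1.
  apply: (mulfI (lt0r_neq0 (exprn_gt0 2 k0))).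
  by rewrite eW mulrBr mulr1 mulfV // lt0r_neq0 // exprn_gt0.
have -> : d%:R ^+ 2 = (m'^-2 - 1) * (k'^-2 - 1).
  apply: (mulIf (lt0r_neq0 (mulr_gt0 (exprn_gt0 2 m'0) (exprn_gt0 2 k'0)))).
  by rewrite e'; field; rewrite !lt0r_neq0.
rewrite Y2 W2; apply: ler_pM.
- by rewrite -Y2 sqr_ge0.
- by rewrite -W2 sqr_ge0.
- by rewrite lerD2r lef_pV2 ?posrE ?exprn_gt0.
- by rewrite lerD2r lef_pV2 ?posrE ?exprn_gt0.
Qed.

End Spherical.

Theorem mainTheorem10 (R : realType) :
  (forall (d : nat), (2 <= d)%N ->
     forall v : 'I_d.+1 -> 'rV[R]_d.+1, is_hyp_simplex v ->
       tanhR (h_cirr (hsimplex v)) >= d%:R * tanhR (h_ir (hsimplex v)) /\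
       (tanhR (h_cirr (hsimplex v)) = d%:R * tanhR (h_ir (hsimplex v))
          <-> h_regular v)) /\
  (forall (d : nat), (d == 2)%N || (d == 3)%N ->
     forall v : 'I_d.+1 -> 'rV[R]_d.+1, is_sph_simplex v ->
       tan (s_cirr (ssimplex v)) >= d%:R * tan (s_ir (ssimplex v)) /\
       (tan (s_cirr (ssimplex v)) = d%:R * tan (s_ir (ssimplex v))
          <-> s_regular v)).
Proof.
split=> d d2 v; first exact: hyp_simplex_tanh.
by apply: sph_simplex_tan; case/orP: d2 => /eqP ->.
Qed.
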